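(* Let $\mathfrak{R}\in\mathcal{M}_{l,m}$ have rank $r+k$ greater than $r$, with singular value decomposition $\mathfrak{R}=\sum_{i=1}^{r+k}\sigma_iu_iv_i^T$, the singular values being ordered decreasingly: $\sigma_1\ge\sigma_2\ge\dots\ge\sigma_{r+k}$. Suppose that the orthogonal projection $\Pi_{\mathscr{M}}(\mathfrak{R})=UZ^T$ of $\mathfrak{R}$ onto $\mathscr{M}$ is uniquely defined, that is $\sigma_r>\sigma_{r+1}$. Then $\Pi_{\mathscr{M}}$, the truncated SVD of order $r$, is differentiable at $\mathfrak{R}$, and its differential in a direction $\mathfrak{X}\in\mathcal{M}_{l,m}$ is given by the formula $$\mathrm{D}_{\mathfrak{X}}\Pi_{\mathscr{M}}(\mathfrak{R})=\Pi_{\mathcal{T}(\Pi_{\mathscr{M}}(\mathfrak{R}))}(\mathfrak{X})+\sum_{\substack{1\le i\le r\\1\le j\le k}}\left[\frac{\sigma_{r+j}}{\sigma_i-\sigma_{r+j}}\langle\mathfrak{X},\Phi_{i,r+j}^+\rangle\Phi_{i,r+j}^+-\frac{\sigma_{r+j}}{\sigma_i+\sigma_{r+j}}\langle\mathfrak{X},\Phi_{i,r+j}^-\rangle\Phi_{i,r+j}^-\right],$$ where $\Phi_{i,r+j}^{\pm}=\frac{1}{\sqrt2}(u_{r+j}v_i^T\pm u_iv_{r+j}^T)$. More explicitly, $$\begin{aligned}\mathrm{D}_{\mathfrak{X}}\Pi_{\mathscr{M}}(\mathfrak{R})&=(I-UU^T)\mathfrak{X}Z(Z^TZ)^{-1}Z^T+UU^T\mathfrak{X}\\&\quad+\sum_{\substack{1\le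 i\le r\\1\le j\le k}}\frac{\sigma_{r+j}}{\sigma_i^2-\sigma_{r+j}^2}\Big[(\sigma_iu_{r+j}^T\mathfrak{X}v_i+\sigma_{r+j}u_i^T\mathfrak{X}v_{r+j})u_{r+j}v_i^T\\&\qquad\qquad+(\sigma_{r+j}u_{r+j}^T\mathfrak{X}v_i+\sigma_iu_i^T\mathfrak{X}v_{r+j})u_iv_{r+j}^T\Big].\end{aligned}$$
   Context: $\mathcal{M}_{l,m}$ is the space of $l\times m$ real matrices with the Frobenius inner product $\langle A,B\rangle=\mathrm{Tr}(A^TB)$ and norm. $\mathscr{M}=\{R\in\mathcal{M}_{l,m} : \mathrm{rank}(R)=r\}$ is the fixed rank manifold; its points are written $R=UZ^T$ with $U\in\mathcal{M}_{l,r}$, $U^TU=I$, $Z\in\mathcal{M}_{m,r}$, $\mathrm{rank}(Z)=r$. $\mathcal{T}(R)$ is the tangent space of $\mathscr{M}$ at $R$ and $\Pi_{\mathcal{T}(R)}$ the orthogonal projection of $\mathcal{M}_{l,m}$ onto it. $\Pi_{\mathscr{M}}(\mathfrak{R})$ denotes the unique point of $\mathscr{M}$ minimizing $R\mapsto\|\mathfrak{R}-R\|$ over $\mathscr{M}$; it is defined when $\sigma_r(\mathfrak{R})>\sigma_{r+1}(\mathfrak{R})$ and equals the rank $r$ truncated SVD $\sum_{i=1}^r\sigma_iu_iv_i^T$. $\mathrm{D}_{\mathfrak{X}}f(\mathfrak{R})$ is the differential of $f$ at $\mathfrak{R}$ in direction $\mathfrak{X}$.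
   Formalization: In the explicit formula the two scalar brackets are interchanged relative to the English: as printed it contradicts the first formula and fails for diag(2,1), X=E_21; the correct coefficient of u_{r+j}v_i^T is σ_{r+j}u_{r+j}^TXv_i+σ_iu_i^TXv_{r+j}, and the other bracket goes with u_iv_{r+j}^T. *)

(* Defs.v *)
From mathcomp Require Import all_boot all_order all_algebra.
From mathcomp Require Import all_classical all_reals all_analysis.
Set Implicit Arguments.
Unset Strict Implicit.
Unset Printing Implicit Defensive.
Import Order.TTheory GRing.Theory Num.Theory.
Import numFieldNormedType.Exports.
Local Open Scope classical_set_scope.
Local Open Scope ring_scope.

(* The topology of 'M[R]_(l, m) is the library's, given by the max norm. It is
   the same as that of the Frobenius norm, so differentiability and
   differentials do not depend on this choice. Distances and orthogonality
   below are those of the Frobenius inner product. *)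
Definition frob (R : realType) (l m : nat) (A B : 'M[R]_(l, m)) : R :=
  \tr (A^T *m B).

Definition frob_norm (R : realType) (l m : nat) (A : 'M[R]_(l, m)) : R :=
  Num.sqrt (frob A A).

Definition fixed_rank (R : realType) (l m r : nat) : set 'M[R]_(l, m) :=
  [set Y | \rank Y = r].

Definition is_nearest (R : realType) (l m : nat) (S : set 'M[R]_(l, m))
    (A Y : 'M[R]_(l, m)) : Prop :=
  S Y /\ forall W, S W -> frob_norm (A - Y) <= frob_norm (A - W).

(* The value is 0, a junk value, at the points A that have no nearest point in
   the manifold or several of them. *)
Definition rank_proj (R : realType) (l m r : nat) (A : 'M[R]_(l, m)) :
    'M[R]_(l, m) :=
  xget 0 [set Y | is_nearest (@fixed_rank R l m r) A Y /\
                  forall W, is_nearest (@fixed_rank R l m r) A W -> W = Y].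

(* Velocities at Y of the smooth (of class C^oo) curves drawn on S. The curve g
   matters only on ]- e, e[. *)
Definition tangent_space (R : realType) (l m : nat) (S : set 'M[R]_(l, m))
    (Y : 'M[R]_(l, m)) : set 'M[R]_(l, m) :=
  [set T | exists (g : R -> 'M[R]_(l, m)) (e : R),
     [/\ 0 < e,
         forall t : R, `|t| < e -> S (g t),
         forall (t : R) (n : nat), `|t| < e -> derivable (derive1n n g) t 1,
         g 0 = Y
       & derive1 g 0 = T]].

(* When T is a linear subspace, exactly one P satisfies the condition. *)
Definition orth_proj (R : realType) (l m : nat) (T : set 'M[R]_(l, m))
    (X : 'M[R]_(l, m)) : 'M[R]_(l, m) :=
  xget 0 [set P | T P /\ forall W, T W -> frob (X - P) W = 0].

(* Singular triples are numbered from 1 to n; the values of sigma, u and v at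
   the other indices are irrelevant. *)
Definition is_svd (R : realType) (l m n : nat) (A : 'M[R]_(l, m))
    (sigma : nat -> R) (u : nat -> 'cV[R]_l) (v : nat -> 'cV[R]_m) : Prop :=
  [/\ forall i j, (1 <= i <= n)%N -> (1 <= j <= n)%N ->
        (u i)^T *m u j = (i == j)%:R%:M,
      forall i j, (1 <= i <= n)%N -> (1 <= j <= n)%N ->
        (v i)^T *m v j = (i == j)%:R%:M,
      forall i, (1 <= i <= n)%N -> 0 <= sigma i,
      forall i j, (1 <= i)%N -> (i <= j)%N -> (j <= n)%N -> sigma j <= sigma i
    & A = \sum_(1 <= i < n.+1) sigma i *: (u i *m (v i)^T)].

(* The scalar a^T X b. *)
Definition bilin (R : realType) (l m : nat) (a : 'cV[R]_l) (X : 'M[R]_(l, m))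
    (b : 'cV[R]_m) : R :=
  (a^T *m X *m b) 0 0.

Definition Phi_plus (R : realType) (l m : nat) (u : nat -> 'cV[R]_l)
    (v : nat -> 'cV[R]_m) (i p : nat) : 'M[R]_(l, m) :=
  (Num.sqrt 2)^-1 *: (u p *m (v i)^T + u i *m (v p)^T).

Definition Phi_minus (R : realType) (l m : nat) (u : nat -> 'cV[R]_l)
    (v : nat -> 'cV[R]_m) (i p : nat) : 'M[R]_(l, m) :=
  (Num.sqrt 2)^-1 *: (u p *m (v i)^T - u i *m (v p)^T).

(* Main.v *)
Require Import Defs.
From mathcomp Require Import all_boot all_order all_algebra.
From mathcomp Require Import all_classical all_reals all_analysis.
From mathcomp Require Import ring lra.
From HB Require Import structures.
Set Implicit Arguments.
Unset Strict Implicit.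
Unset Printing Implicit Defensive.
Import Order.TTheory GRing.Theory Num.Theory.
Import numFieldNormedType.Exports.
Local Open Scope classical_set_scope.
Local Open Scope ring_scope.

(** Write S(B) = B B^T. By Ky Fan's inequality, if P is a spectral projection of
    S(B) of rank r whose eigenvalues are at least a, the others being at most
    b < a, then for every orthogonal projection Pi of rank r
    (a - b)/2 |Pi - P|^2 <= tr (P S(B)) - tr (Pi S(B)). Applied to the projection
    onto the column space of a rank r matrix, this makes P B the unique nearest
    point to B. Near A, a maximizer Pi of tr (Pi S(A + H)) over the compact set of
    projections of rank r commutes with S(A + H) by a first variation argument,
    and the same inequality gives E = Pi - P = O(H), so that Pi has a spectral gap
    too and the nearest point to A + H is Pi (A + H). Idempotence of Pi gives
    E = Q E P + P E Q + O(H^2) with Q = 1 - P, and commutation turns into a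
    Sylvester equation for Q E P, whose solution has an explicit expression on the
    singular vectors. This proves a second order expansion of the projection.

    At a point Y of the manifold the projection fixes nearby points of the manifold,
    hence its differential fixes the tangent vectors, which therefore satisfy
    T = P T + Q T N, with N the projection onto the row space of Y; conversely such
    a T is the velocity of the curve (1 + t B) Y (1 + t C) for suitable B and C. *)

(** * Entrywise proofs of linear matrix identities *)

Section MatrixLinear.
Context {R : realType} {m n : nat}.
Implicit Types A B : 'M[R]_(m, n).

Lemma mxDE A B i j : (A + B) i j = A i j + B i j. Proof. by rewrite mxE. Qed.
Lemma mxNE A i j : (- A) i j = - A i j. Proof. by rewrite mxE. Qed.
Lemma mxZE (a : R) A i j : (a *: A) i j = a * A i j. Proof. by rewrite mxE. Qed.
Lemma mx0E i j : (0 : 'M[R]_(m, n)) i j = 0. Proof. by rewrite mxE. Qed.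

End MatrixLinear.

Definition mxlinE := (@mxDE, @mxNE, @mxZE, @mx0E).
Definition mxmulE :=
  (@mulmxDl, @mulmxDr, @mulmxBl, @mulmxBr, @mulNmx, @mulmxN, @mul1mx, @mulmx1,
   @mul0mx, @mulmx0, @mulmxA).
(* [mxmulE] leaves sums of monomials, which are scalars entrywise. *)
Ltac mxlin := rewrite ?mxmulE; apply/matrixP => ? ?; rewrite ?mxlinE; ring.

(** * Frobenius inner product and max norm *)

Section Frobenius.
Context {R : realType}.

Lemma frobE {m n} (A B : 'M[R]_(m, n)) :
  frob A B = \sum_j \sum_i A i j * B i j.
Proof.
rewrite /frob /mxtrace; apply: eq_bigr => j _; rewrite mxE.
by apply: eq_bigr => i _; rewrite mxE.
Qed.

Lemma frobC {m n} (A B : 'M[R]_(m, n)) : frob A B = frob B A.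
Proof.
by rewrite !frobE; apply: eq_bigr => j _; apply: eq_bigr => i _; rewrite mulrC.
Qed.

Lemma frobDl {m n} (A B C : 'M[R]_(m, n)) :
  frob (A + B) C = frob A C + frob B C.
Proof. by rewrite /frob linearD /= mulmxDl linearD. Qed.

Lemma frobDr {m n} (A B C : 'M[R]_(m, n)) :
  frob A (B + C) = frob A B + frob A C.
Proof. by rewrite /frob mulmxDr linearD. Qed.

Lemma frobNl {m n} (A B : 'M[R]_(m, n)) : frob (- A) B = - frob A B.
Proof. by rewrite /frob linearN /= mulNmx linearN. Qed.

Lemma frobNr {m n} (A B : 'M[R]_(m, n)) : frob A (- B) = - frob A B.
Proof. by rewrite frobC frobNl frobC. Qed.

Lemma frobZl {m n} (a : R) (A B : 'M[R]_(m, n)) : frob (a *: A) B = a * frob A B.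
Proof. by rewrite /frob linearZ /= -scalemxAl linearZ. Qed.

Lemma frobZr {m n} (a : R) (A B : 'M[R]_(m, n)) : frob A (a *: B) = a * frob A B.
Proof. by rewrite frobC frobZl frobC. Qed.

Lemma frob0l {m n} (A : 'M[R]_(m, n)) : frob 0 A = 0.
Proof. by rewrite /frob trmx0 mul0mx mxtrace0. Qed.

Lemma frob_mulmxl {m n p} (A : 'M[R]_(m, n)) (B : 'M[R]_(n, p)) C :
  frob (A *m B) C = frob B (A^T *m C).
Proof. by rewrite /frob trmx_mul mulmxA. Qed.

Lemma frob_ge0 {m n} (A : 'M[R]_(m, n)) : 0 <= frob A A.
Proof.
by rewrite frobE; apply: sumr_ge0 => j _; apply: sumr_ge0 => i _; rewrite -expr2 sqr_ge0.
Qed.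

Lemma sqr_entry_le_frob {m n} (A : 'M[R]_(m, n)) i j : A i j ^+ 2 <= frob A A.
Proof.
rewrite frobE (bigD1 j) //= (bigD1 i) //= -expr2 -addrA lerDl addr_ge0 //.
  by apply: sumr_ge0 => k _; rewrite -expr2 sqr_ge0.
by apply: sumr_ge0 => k _; apply: sumr_ge0 => k' _; rewrite -expr2 sqr_ge0.
Qed.

Lemma frob_eq0 {m n} (A : 'M[R]_(m, n)) : frob A A <= 0 -> A = 0.
Proof.
move=> A0; apply/matrixP => i j; rewrite mxE; apply/eqP; rewrite -sqrf_eq0.
by rewrite eq_le sqr_ge0 andbT (le_trans (sqr_entry_le_frob A i j)).
Qed.

Lemma normr_entry_le {m n} (A : 'M[R]_(m, n)) i j : `|A i j| <= `|A|.
Proof.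
rewrite [`|A|]mx_normrE.
by apply: (le_trans _ (le_bigmax _ _ (i, j))).
Qed.

Lemma mx_norm_le {m n} (A : 'M[R]_(m, n)) c : 0 <= c ->
  (forall i j, `|A i j| <= c) -> `|A| <= c.
Proof.
by move=> c0 Ac; rewrite [`|A|]mx_normrE; apply: bigmax_le => // -[i j] _ /=.
Qed.

Lemma natr_mul_sum n (x : R) : n%:R * x = \sum_(k < n) x.
Proof. by rewrite sumr_const card_ord mulr_natl. Qed.

Lemma normr_mulmx {m n p} (A : 'M[R]_(m, n)) (B : 'M[R]_(n, p)) :
  `|A *m B| <= n%:R * (`|A| * `|B|).
Proof.
apply: mx_norm_le => [|i j]; first by rewrite !mulr_ge0.
rewrite mxE (le_trans (ler_norm_sum _ _ _)) //.
rewrite natr_mul_sum.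
by apply: ler_sum => k _; rewrite normrM ler_pM // normr_entry_le.
Qed.

Lemma normr_trmx {m n} (A : 'M[R]_(m, n)) : `|A^T| <= `|A|.
Proof. by apply: mx_norm_le => // i j; rewrite mxE normr_entry_le. Qed.

(** Links the max norm, which carries the topology, to the Frobenius norm, for which distances are
    minimized. *)
Lemma sqr_normr_le_frob {m n} (A : 'M[R]_(m, n)) : `|A| ^+ 2 <= frob A A.
Proof.
rewrite -[leRHS]sqr_sqrtr ?frob_ge0 // lerXn2r ?nnegrE ?sqrtr_ge0 //.
apply: mx_norm_le => [|i j]; first exact: sqrtr_ge0.
by rewrite -sqrtr_sqr ler_wsqrtr // sqr_entry_le_frob.
Qed.

Lemma normr_frob_le {m n} (A B : 'M[R]_(m, n)) :
  `|frob A B| <= (n * m)%:R * (`|A| * `|B|).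
Proof.
rewrite frobE natrM -mulrA natr_mul_sum.
rewrite (le_trans (ler_norm_sum _ _ _)) //; apply: ler_sum => j _.
rewrite natr_mul_sum.
rewrite (le_trans (ler_norm_sum _ _ _)) //; apply: ler_sum => i _.
by rewrite normrM ler_pM // normr_entry_le.
Qed.

(** Each product [|W i j| * |W k j|] is at most half the sum of the squares. Summing over [i] and
    [k] counts every square [m] times, whence the factor [m]. *)
Lemma normr_quad_le {m n} (K : 'M[R]_m) (W : 'M[R]_(m, n)) :
  `|frob W (K *m W)| <= m%:R * `|K| * frob W W.
Proof.
rewrite !frobE mulr_sumr (le_trans (ler_norm_sum _ _ _)) //.
apply: ler_sum => j _.
have -> : \sum_i W i j * (K *m W) i j = \sum_i \sum_k W i j * K i k * W k j.
  by apply: eq_bigr => i _; rewrite mxE mulr_sumr; apply: eq_bigr => k _; rewrite mulrA.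
apply: (@le_trans _ _ (\sum_i \sum_k
    ((`|K| / 2) * (W i j * W i j) + (`|K| / 2) * (W k j * W k j)))).
  rewrite (le_trans (ler_norm_sum _ _ _)) //; apply: ler_sum => i _.
  rewrite (le_trans (ler_norm_sum _ _ _)) //; apply: ler_sum => k _.
  rewrite !normrM mulrAC.
  have h : `|W i j| * `|W k j| <= (W i j * W i j + W k j * W k j) / 2.
    rewrite -!expr2 -(real_normK (num_real (W i j))) -(real_normK (num_real (W k j))).
    have := sqr_ge0 (`|W i j| - `|W k j|); lra.
  have hK := normr_entry_le K i k.
  apply: (@le_trans _ _ ((W i j * W i j + W k j * W k j) / 2 * `|K|)).
    by apply: ler_pM => //; rewrite ?mulr_ge0.
  lra.
set s := \sum_(i < m) W i j * W i j.
under eq_bigr do rewrite big_split /= -mulr_sumr -natr_mul_sum -/s.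
rewrite big_split /= -natr_mul_sum -!mulr_sumr -/s.
lra.
Qed.

End Frobenius.

(** * Orthogonal projections, Ky Fan's inequality and nearest matrices of rank r *)

Section Projections.
Context {R : realType}.

Definition is_oproj {l} (P : 'M[R]_l) := P^T = P /\ P *m P = P.

(** The spectrum is described by Rayleigh quotients, without diagonalizing [S]. Test matrices [W] of
    any width allow a whole projection to be inserted for [W]. *)
Definition spectral_gap {l} (P S : 'M[R]_l) (a b : R) :=
  [/\ is_oproj P, P *m S = S *m P,
      forall n (W : 'M[R]_(l, n)),
        a * frob (P *m W) (P *m W) <= frob (P *m W) (S *m (P *m W))
    & forall n (W : 'M[R]_(l, n)),
        frob ((1%:M - P) *m W) (S *m ((1%:M - P) *m W)) <=
        b * frob ((1%:M - P) *m W) ((1%:M - P) *m W)].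

Lemma is_oprojC {l} (P : 'M[R]_l) : is_oproj P -> is_oproj (1%:M - P).
Proof.
move=> [PT PP]; split; first by rewrite linearB /= trmx1 PT.
by rewrite !mxmulE PP; mxlin.
Qed.

Lemma oprojK {l n} (P : 'M[R]_l) (W : 'M[R]_(n, l)) :
  is_oproj P -> W *m P *m P = W *m P.
Proof. by case=> _ PP; rewrite -mulmxA PP. Qed.

Lemma oproj_compl {l n} (P : 'M[R]_l) (W : 'M[R]_(l, n)) :
  is_oproj P -> P *m ((1%:M - P) *m W) = 0.
Proof. by case=> _ PP; rewrite mulmxA mulmxBr mulmx1 PP subrr mul0mx. Qed.

Lemma frob_oproj {l n} (P : 'M[R]_l) (W : 'M[R]_(l, n)) : is_oproj P ->
  frob (P *m W) (P *m W) = frob W (P *m W).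
Proof. by case=> PT PP; rewrite frob_mulmxl PT mulmxA PP. Qed.

Lemma frob_oproj_split {l n} (P : 'M[R]_l) (W : 'M[R]_(l, n)) : is_oproj P ->
  frob W W = frob (P *m W) (P *m W) + frob ((1%:M - P) *m W) ((1%:M - P) *m W).
Proof.
move=> hP; rewrite !frob_oproj //; last exact: is_oprojC.
by rewrite mulmxBl mul1mx frobDr frobNr addrC subrK.
Qed.

Lemma frob_oproj_tr {l} (P Q : 'M[R]_l) : is_oproj P -> is_oproj Q ->
  frob (P *m Q) (P *m Q) = \tr (P *m Q).
Proof.
move=> hP [QT QQ]; rewrite frob_oproj // /frob QT mulmxA mxtrace_mulC mulmxA QQ.
exact: mxtrace_mulC.
Qed.

(** In a rank factorization [P = C D], cancelling the full rank factors in [P P = P] gives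
    [D C = 1], and [P] has the trace of [D C]. *)
Lemma mxtrace_oproj {l} (P : 'M[R]_l) : is_oproj P -> \tr P = (\rank P)%:R.
Proof.
case=> _ PP; rewrite -{1}(mulmx_base P) mxtrace_mulC.
suff -> : row_base P *m col_base P = 1%:M by rewrite mxtrace1.
have /row_fullP [B BC] := col_base_full P.
have /row_freeP [D RD] := row_base_free P.
have : B *m (P *m P) *m D = B *m P *m D by rewrite PP.
move: (mulmx_base P) B BC D RD; move: (col_base P) (row_base P).
move: (\rank P) => k C E <- B BC D ED.
by rewrite !mulmxA BC mul1mx -!mulmxA ED !mulmx1.
Qed.

(** If [K C^T C = 0] then [C K^T] has Frobenius norm 0, and a left inverse of [C] gives [K = 0]. *)
Lemma gram_unitmx {l n} (C : 'M[R]_(l, n)) : \rank C = n -> C^T *m C \in unitmx.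
Proof.
move=> rC; have /row_fullP [B BC] : row_full C by rewrite /row_full rC.
rewrite -row_free_unit -kermx_eq0; apply/eqP.
set K := kermx _; have KC : K *m (C^T *m C) = 0 by exact: mulmx_ker.
suff h : C *m K^T = 0.
  by rewrite -[LHS]trmxK -[K^T]mul1mx -BC -mulmxA h mulmx0 trmx0.
apply: frob_eq0; rewrite /frob trmx_mul trmxK mulmxA -(mulmxA K) KC.
by rewrite mul0mx mxtrace0.
Qed.

Lemma oproj_gram {l n} (C : 'M[R]_(l, n)) : \rank C = n ->
  is_oproj (C *m invmx (C^T *m C) *m C^T).
Proof.
move=> rC; have uC := gram_unitmx rC; split.
  by rewrite !trmx_mul trmxK trmx_inv trmx_mul trmxK mulmxA.
by rewrite -!mulmxA (mulmxA C^T C) (mulmxA (invmx _)) mulVmx // mul1mx.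
Qed.

(** A rank factorization [W = C D] reduces this to the projection [C (C^T C)^-1 C^T] on the columns
    of [C]. *)
Lemma col_oproj {l m} (W : 'M[R]_(l, m)) :
  exists P : 'M[R]_l, [/\ is_oproj P, \tr P = (\rank W)%:R & P *m W = W].
Proof.
suff h k (C : 'M[R]_(l, k)) (D : 'M[R]_(k, m)) : \rank C = k ->
    exists P : 'M[R]_l, [/\ is_oproj P, \tr P = k%:R & P *m (C *m D) = C *m D].
  have [|P] := h _ (col_base W) (row_base W); last by rewrite mulmx_base; exists P.
  exact/eqP/col_base_full.
move=> rC; have uC := gram_unitmx rC.
exists (C *m invmx (C^T *m C) *m C^T); split; first exact: oproj_gram.
  by rewrite mxtrace_mulC mulmxA mulmxV // mxtrace1.
by rewrite -!mulmxA (mulmxA C^T C) (mulmxA (invmx _)) mulVmx // mul1mx.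
Qed.

Lemma frob_sub_oproj {l} (P Q : 'M[R]_l) : is_oproj P -> is_oproj Q ->
  \tr Q = \tr P -> frob (Q - P) (Q - P) = 2 * (\tr P - \tr (P *m Q)).
Proof.
move=> [PT PP] [QT QQ] tQ; rewrite /frob (_ : (Q - P)^T = Q - P); last by rewrite linearB /= PT QT.
rewrite !mxmulE PP QQ.
by rewrite !(mxtraceD, raddfN) /= (mxtrace_mulC Q P) tQ; ring.
Qed.

Lemma quad_oproj_tr {l} (P Q S : 'M[R]_l) : is_oproj P -> is_oproj Q ->
  P *m S = S *m P -> frob (P *m Q) (S *m (P *m Q)) = \tr (P *m S *m Q).
Proof.
move=> [PT PP] [QT QQ] PS; rewrite frob_mulmxl PT /frob QT.
have -> : P *m (S *m (P *m Q)) = P *m S *m Q.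
  by rewrite (mulmxA S) -PS !mulmxA PP.
by rewrite mxtrace_mulC -[_ *m Q *m Q]mulmxA QQ.
Qed.

(** The gap is tested on [W = 1 - Q] for the lower bound and on [W = Q] for the upper one. The
    squared norms that appear, [tr (P (1 - Q))] and [tr ((1 - P) Q)], both equal half of [|Q - P|^2]
    since the traces of [P] and [Q] agree. *)
Lemma ky_fan {l} (P Q S : 'M[R]_l) a b : spectral_gap P S a b ->
  is_oproj Q -> \tr Q = \tr P ->
  (a - b) / 2 * frob (Q - P) (Q - P) <= \tr (P *m S) - \tr (Q *m S).
Proof.
move=> [hP PS ha hb] hQ tQ; rewrite frob_sub_oproj //.
have hQ' := is_oprojC hQ; have hP' := is_oprojC hP.
have := ha _ (1%:M - Q); have := hb _ Q.
rewrite !frob_oproj_tr // !quad_oproj_tr //; last by rewrite !mxmulE PS.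
rewrite !mxmulE !(mxtraceD, raddfN) /= tQ (mxtrace_mulC S Q).
by move=> *; lra.
Qed.

Lemma eckart_young {l m} r (B : 'M[R]_(l, m)) P a b :
  spectral_gap P (B *m B^T) a b -> b < a -> 0 < a -> \tr P = r%:R ->
  rank_proj r B = P *m B.
Proof.
move=> gP ba a0 tP; have [hP PS ha _] := gP.
have fBP Q : is_oproj Q -> frob (Q *m B) (Q *m B) = \tr (Q *m (B *m B^T)).
  by move=> hQ; rewrite frob_oproj // /frob mxtrace_mulC mulmxA.
(* With [Q] the projection on the columns of [W], Pythagoras gives
   [|B - W|^2 = |Q B - W|^2 + |B - Q B|^2], and Ky Fan compares the last term with [|B - P B|^2].
   The two surplus squares are kept for uniqueness. *)
have sqB W : fixed_rank r W -> exists Q : 'M[R]_l,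
    [/\ is_oproj Q, \tr Q = r%:R, Q *m W = W &
    (a - b) / 2 * frob (Q - P) (Q - P) + frob (Q *m B - W) (Q *m B - W)
    + frob (B - P *m B) (B - P *m B) <= frob (B - W) (B - W)].
  rewrite /fixed_rank /= => rW; have [Q [hQ tQ QW]] := col_oproj W.
  exists Q; split => //; first by rewrite tQ rW.
  have kf := ky_fan gP hQ (etrans tQ (etrans (congr1 _ rW) (esym tP))).
  rewrite (frob_oproj_split (B - W) hQ) mulmxBr QW.
  rewrite (_ : (1%:M - Q) *m (B - W) = (1%:M - Q) *m B); last first.
    by rewrite mulmxBr [X in _ - X]mulmxBl mul1mx QW subrr subr0.
  have := frob_oproj_split B hQ; have := frob_oproj_split B hP.
  rewrite (fBP P) // (fBP Q) // [(1%:M - P) *m B]mulmxBl mul1mx => -> h.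
  move: kf h; set x := \tr _; set y := \tr _; set f := frob _ _.
  set g := frob (_ *m _ - _) _; set h := frob (B - _) _; lra.
(* The rank does not drop: if [K P B = 0], the lower bound [a > 0] on the range of [P] forces
   [K P = 0]. *)
have rPB : \rank (P *m B) = r.
  have rP : \rank P = r.
    by apply/eqP; rewrite -(eqr_nat R) -mxtrace_oproj // tP.
  apply/eqP; rewrite eqn_leq -{1}rP mxrankM_maxl /=.
  have KP : kermx (P *m B) *m P = 0.
    set K := kermx _; have KB : K *m P *m B = 0 by rewrite -mulmxA; exact: mulmx_ker.
    have PK : B^T *m (P *m K^T) = 0.
      by rewrite -[P in LHS](proj1 hP) -!trmx_mul KB trmx0.
    have := ha _ K^T; rewrite -(mulmxA B) PK mulmx0 [frob _ 0]frobC frob0l.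
    rewrite (pmulr_rle0 _ a0) => /frob_eq0 h.
    by apply: trmx_inj; rewrite trmx_mul (proj1 hP) h trmx0.
  have : (\rank (kermx (P *m B)) <= \rank (kermx P))%N.
    by apply: mxrankS; apply/sub_kermxP.
  by rewrite !mxrank_ker leq_sub2lE ?rP // -rP rank_leq_row.
have near : is_nearest (@fixed_rank R l m r) B (P *m B).
  split => // W /sqB [Q [hQ tQ QW h]]; rewrite ler_wsqrtr //.
  apply: le_trans h; rewrite lerDr addr_ge0 ?frob_ge0 // mulr_ge0 ?frob_ge0 //.
  by rewrite divr_ge0 // subr_ge0 ltW.
(* Equality of the distances makes both surplus squares vanish, so [Q = P] and [W = Q B]. *)
have uniq W : is_nearest (@fixed_rank R l m r) B W -> W = P *m B.
  move=> [rW /(_ _ (proj1 near))]; rewrite ler_psqrt ?nnegrE ?frob_ge0 // => le.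
  have [Q [hQ tQ QW h]] := sqB W rW.
  have ab : 0 < (a - b) / 2 by rewrite divr_gt0 // subr_gt0.
  have e0 : frob (Q - P) (Q - P) <= 0.
    rewrite -(pmulr_rle0 _ ab).
    by have := frob_ge0 (Q *m B - W); lra.
  have e1 : frob (Q *m B - W) (Q *m B - W) <= 0.
    by have := mulr_ge0 (ltW ab) (frob_ge0 (Q - P)); lra.
  move: (frob_eq0 e0) (frob_eq0 e1) => /subr0_eq -> /subr0_eq ->//.
rewrite /rank_proj; case: xgetP => [Y -> [nY _]|/(_ (P *m B))]; first exact: uniq.
by case; split.
Qed.

End Projections.

(** * Continuity of matrix expressions, entry by entry *)

Section ContinuousEntries.
Context {R : realType} {T : topologicalType}.

Definition continuous_entries {m n} (F : T -> 'M[R]_(m, n)) :=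
  forall i j, continuous (fun x => F x i j).

Lemma continuous_sum n (F : 'I_n -> T -> R) :
  (forall i, continuous (F i)) -> continuous (fun x => \sum_i F i x).
Proof.
move=> cF x; apply: (@cvg_big R _ (+%R : R -> R -> R) 0 xpredT).
  exact: add_continuous.
by move=> i _; apply: cF.
Qed.

Lemma continuous_entries_cst {m n} (A : 'M[R]_(m, n)) :
  continuous_entries (fun _ => A).
Proof. by move=> i j; apply: cst_continuous. Qed.

Lemma continuous_entriesB {m n} (F G : T -> 'M[R]_(m, n)) :
  continuous_entries F -> continuous_entries G ->
  continuous_entries (fun x => F x - G x).
Proof.
move=> cF cG i j x; under eq_fun do rewrite !mxlinE.
by apply: cvgB; [exact: cF|exact: cG].
Qed.

Lemma continuous_entries_tr {m n} (F : T -> 'M[R]_(m, n)) :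
  continuous_entries F -> continuous_entries (fun x => (F x)^T).
Proof. by move=> cF i j x; under eq_fun do rewrite mxE; exact: cF. Qed.

Lemma continuous_entriesM {m n p} (F : T -> 'M[R]_(m, n)) (G : T -> 'M[R]_(n, p)) :
  continuous_entries F -> continuous_entries G ->
  continuous_entries (fun x => F x *m G x).
Proof.
move=> cF cG i j.
have -> : (fun x => (F x *m G x) i j) = (fun x => \sum_k F x i k * G x k j).
  by apply/funext => x; rewrite mxE.
apply: continuous_sum => k x.
by apply: cvgM; [exact: cF|exact: cG].
Qed.

Lemma continuous_mxtrace {n} (F : T -> 'M[R]_n) :
  continuous_entries F -> continuous (fun x => \tr (F x)).
Proof. by move=> cF; apply: continuous_sum => i; apply: cF. Qed.

End ContinuousEntries.

(** * Existence of a projection maximizing the trace *)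

Section MaximalProjection.
Context {R : realType}.

Lemma vec_mx_continuous {l} : continuous_entries (fun x : 'rV[R]_(l * l) => vec_mx x).
Proof. by move=> i j x; under eq_fun do rewrite mxE; exact: coord_continuous. Qed.

(** Closed and bounded: the squared max norm of a projection is at most its squared Frobenius norm,
    which is its trace [r]. Matrices are flattened to row vectors to apply the extreme value theorem
    [EVT_max_rV]. *)
Lemma compact_oproj {l} (r : R) :
  compact [set x : 'rV[R]_(l * l) | is_oproj (vec_mx x) /\ \tr (vec_mx x) = r].
Proof.
set K := [set x | _]; apply: bounded_closed_compact.
  exists (r + 1); split; first exact: num_real.
  move=> M rM x [hP tP] /=; apply: le_trans (ltW rM).
  have : `|vec_mx x| ^+ 2 <= r.
    rewrite -tP (le_trans (sqr_normr_le_frob _)) //.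
    by case: hP => PT PP; rewrite /frob PT PP.
  have : `|x| <= `|vec_mx x|.
    apply: mx_norm_le => // i j; rewrite -[x]vec_mxK.
    by case/mxvec_indexP: j => a b; rewrite ord1 mxvecE vec_mxK normr_entry_le.
  (* This square gives [x <= x^2 + 1/4], so [x^2 <= r] implies [x <= r + 1]. *)
  have := sqr_ge0 (`|vec_mx x| - 1 / 2); nra.
(* Symmetry and idempotence become the vanishing of one continuous sum of squares. *)
pose phi (x : 'rV[R]_(l * l)) : R :=
  frob ((vec_mx x)^T - vec_mx x) ((vec_mx x)^T - vec_mx x) +
  frob (vec_mx x *m vec_mx x - vec_mx x) (vec_mx x *m vec_mx x - vec_mx x).
have -> : K = (phi @^-1` [set 0]) `&` ((fun x => \tr (vec_mx x)) @^-1` [set r]).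
  apply/seteqP; split => x; rewrite /K /phi /=.
    by move=> [[-> ->] ->]; rewrite !subrr !frob0l addr0.
  set a := frob _ _; set b := frob _ _ => -[ab tx].
  have a0 : 0 <= a by exact: frob_ge0.
  have b0 : 0 <= b by exact: frob_ge0.
  split => //; split.
  - by apply/subr0_eq/frob_eq0; rewrite -/a; lra.
  - by apply/subr0_eq/frob_eq0; rewrite -/b; lra.
have cV := @vec_mx_continuous l.
have cT := continuous_entries_tr cV.
have cfrob m n (F : 'rV[R]_(l * l) -> 'M[R]_(m, n)) :
    continuous_entries F -> continuous (fun x => frob (F x) (F x)).
  by move=> cF; apply/continuous_mxtrace/continuous_entriesM => //; exact: continuous_entries_tr.
apply: closedI; apply: preimage_closed; try exact: closed_eq.
- have c1 := cfrob _ _ _ (continuous_entriesB cT cV).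
  have c2 := cfrob _ _ _ (continuous_entriesB (continuous_entriesM cV cV) cV).
  by move=> x _; exact: (cvgD (c1 x) (c2 x)).
- have c : continuous (fun x : 'rV[R]_(l * l) => \tr (vec_mx x)).
    exact: continuous_mxtrace.
  by move=> x _; exact: c.
Qed.

Lemma max_oproj {l} (P S : 'M[R]_l) : is_oproj P ->
  exists Q : 'M[R]_l, [/\ is_oproj Q, \tr Q = \tr P &
    forall Q', is_oproj Q' -> \tr Q' = \tr P -> \tr (Q' *m S) <= \tr (Q *m S)].
Proof.
move=> hP; have cK := @compact_oproj l (\tr P).
have [||x] := @EVT_max_rV R _ (fun x => \tr (vec_mx x *m S)) _ _ cK.
- by exists (mxvec P) => /=; rewrite mxvecK.
- apply: continuous_subspaceT; apply/continuous_mxtrace/continuous_entriesM.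
    exact: vec_mx_continuous.
  exact: continuous_entries_cst.
rewrite inE => -[hQ tQ] max; exists (vec_mx x); split => // Q' hQ' tQ'.
by rewrite -[Q']mxvecK; apply: max; rewrite inE /= mxvecK.
Qed.

End MaximalProjection.

(** * First variation: a maximizing projection commutes with S *)

Section MaximizerCommutes.
Context {R : realType}.

Lemma mulmx_cV {l} (x y : 'cV[R]_l) : x^T *m y = (frob x y)%:M.
Proof. by rewrite /frob trace_mx11 -mx11_scalar. Qed.

Lemma oproj_line {l} (x : 'cV[R]_l) : frob x x != 0 ->
  is_oproj ((frob x x)^-1 *: (x *m x^T)).
Proof.
move=> x0; split; first by rewrite linearZ /= trmx_mul trmxK.
rewrite -scalemxAl -scalemxAr mulmxA -(mulmxA x) mulmx_cV mul_mx_scalar.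
by rewrite -scalemxAl (scalerA _^-1 (frob x x)) mulVf // scale1r.
Qed.

Lemma oproj_sub_line {l} (Q : 'M[R]_l) (x : 'cV[R]_l) : is_oproj Q ->
  Q *m x = x -> frob x x != 0 -> is_oproj (Q - (frob x x)^-1 *: (x *m x^T)).
Proof.
move=> [QT QQ] Qx /oproj_line; set L := _ *: _ => -[LT LL].
have QL : Q *m L = L by rewrite -scalemxAr mulmxA Qx.
have LQ : L *m Q = L by rewrite -LT -{1}QT -trmx_mul QL.
split; first by rewrite linearB /= QT LT.
by rewrite !mxmulE QQ QL LQ LL; mxlin.
Qed.

Lemma oproj_add_line {l} (Q : 'M[R]_l) (z : 'cV[R]_l) : is_oproj Q ->
  Q *m z = 0 -> frob z z != 0 -> is_oproj (Q + (frob z z)^-1 *: (z *m z^T)).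
Proof.
move=> [QT QQ] Qz /oproj_line; set L := _ *: _ => -[LT LL].
have QL : Q *m L = 0 by rewrite -scalemxAr mulmxA Qz mul0mx scaler0.
have LQ : L *m Q = 0 by rewrite -LT -{1}QT -trmx_mul QL trmx0.
split; first by rewrite linearD /= QT LT.
by rewrite !mxmulE QQ QL LQ LL; mxlin.
Qed.

Lemma mxtrace_line {l} (S : 'M[R]_l) (x : 'cV[R]_l) :
  \tr (x *m x^T *m S) = frob x (S *m x).
Proof. by rewrite /frob -mulmxA mxtrace_mulC -mulmxA. Qed.

(** At [t = q / D] with [D = |d| + 1] the inequality reads [0 <= (q / D)^2 (d - 2 D)], whose last
    factor is negative. *)
Lemma quadratic_le0 (q d : R) : (forall t, 2 * t * q <= t ^+ 2 * d) -> q = 0.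
Proof.
move=> h; set D := `|d| + 1; have D0 : 0 < D by rewrite ltr_wpDl.
have := h (q / D); rewrite -subr_ge0.
have -> : (q / D) ^+ 2 * d - 2 * (q / D) * q = (q / D) ^+ 2 * (d - 2 * D).
  by field; rewrite gt_eqF.
have dD : d - 2 * D < 0 by rewrite /D; have := ler_norm d; have := normr_ge0 d; lra.
rewrite nmulr_lge0 // => h0; apply/eqP.
have : (q / D) ^+ 2 == 0 by rewrite eq_le h0 sqr_ge0.
by rewrite sqrf_eq0 mulf_eq0 invr_eq0 (gt_eqF D0) orbF.
Qed.

(** In the range of [Q], the line of [x] is replaced by the line of [z = x + t y]. The trace is
    unchanged, so maximality bounds the term linear in [t] by a multiple of [t^2], and the linear
    coefficient vanishes. *)
Lemma max_oproj_orth {l} (Q S : 'M[R]_l) (x y : 'cV[R]_l) :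
  is_oproj Q -> S^T = S ->
  (forall Q', is_oproj Q' -> \tr Q' = \tr Q -> \tr (Q' *m S) <= \tr (Q *m S)) ->
  Q *m x = x -> Q *m y = 0 -> frob y (S *m x) = 0.
Proof.
move=> hQ ST max Qx Qy.
have [/frob_eq0 ->|x0] := leP (frob x x) 0; first by rewrite mulmx0 frobC frob0l.
have xy : frob x y = 0.
  by rewrite -Qx frob_mulmxl (proj1 hQ) Qy frobC frob0l.
set a := frob x x in x0; set b := frob y y.
have b0 : 0 <= b := frob_ge0 y.
apply: (@mulfI _ a); first by rewrite gt_eqF.
(* The coefficient of [t^2] is the one left after clearing the denominators [|x|^2] and
   [|z|^2 = a + t^2 b]. *)
rewrite mulr0; apply: (@quadratic_le0 _ (frob x (S *m x) * b - a * frob y (S *m y))) => t.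
have [z zE] : exists z, z = x + t *: y by exists (x + t *: y).
have zz : frob z z = a + t ^+ 2 * b.
  by rewrite zE frobDl !frobDr !frobZl !frobZr xy (frobC y) xy /a /b; ring.
have z0 : 0 < frob z z by rewrite zz ltr_wpDr // mulr_ge0 // sqr_ge0.
have hQ1 := oproj_sub_line hQ Qx (lt0r_neq0 x0).
have Q1z : (Q - (frob x x)^-1 *: (x *m x^T)) *m z = 0.
  rewrite zE mulmxBl !mulmxDr -!scalemxAr Qx Qy scaler0 -!scalemxAl -!mulmxA.
  by rewrite !mulmx_cV xy !mul_mx_scalar scale0r !scaler0 scalerA mulVf ?gt_eqF // scale1r subrr.
have hQ2 := oproj_add_line hQ1 Q1z (lt0r_neq0 z0).
have := max _ hQ2.
have trN (M : 'M[R]_l) : \tr (- M) = - \tr M by exact: raddfN.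
have tl w : \tr (w *m w^T) = frob w w by rewrite mxtrace_mulC.
rewrite !(mxtraceD, trN, mxtraceZ) !tl !mulVf ?gt_eqF // subrK => /(_ erefl).
rewrite !mulmxDl mulNmx -!scalemxAl !(mxtraceD, trN, mxtraceZ) !mxtrace_line.
rewrite zz in z0 *; rewrite zE mulmxDr -scalemxAr.
have sy : frob x (S *m y) = frob y (S *m x) by rewrite frobC frob_mulmxl ST.
rewrite frobDl !frobDr !frobZl !frobZr sy -/a.
set p := frob x _; set q := frob y (S *m x); set w := frob y _.
set g := a + _ in z0 *; move=> h.
have : g^-1 * (p + t * q + (t * q + t * (t * w))) <= a^-1 * p by lra.
rewrite ler_pdivrMl // [g * _]mulrCA ler_pdivlMl //.
rewrite /g; lra.
Qed.

(** Testing the orthogonality on [Q e_j] and [(1 - Q) e_i] kills every entry of [(1 - Q) S Q];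
    transposing kills the other off-diagonal block. *)
Lemma max_oproj_comm {l} (Q S : 'M[R]_l) : is_oproj Q -> S^T = S ->
  (forall Q', is_oproj Q' -> \tr Q' = \tr Q -> \tr (Q' *m S) <= \tr (Q *m S)) ->
  Q *m S = S *m Q.
Proof.
move=> hQ ST max; have [QT QQ] := hQ; have [QT' _] := is_oprojC hQ.
have h : (1%:M - Q) *m S *m Q = 0.
  apply/matrixP => i j; rewrite mx0E.
  have := @max_oproj_orth _ Q S (Q *m delta_mx j 0) ((1%:M - Q) *m delta_mx i 0) hQ ST max.
  rewrite oproj_compl // mulmxA QQ => /(_ erefl erefl).
  have e (M : 'M[R]_l) : \tr (delta_mx (0 : 'I_1) i *m M *m delta_mx j (0 : 'I_1)) = M i j.
    by rewrite -rowE -colE trace_mx11 !mxE.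
  by rewrite /frob trmx_mul QT' trmx_delta => <-; rewrite -e !mulmxA.
have : ((1%:M - Q) *m S *m Q)^T = 0 by rewrite h trmx0.
rewrite !trmx_mul QT' QT ST; move: h; rewrite !mxmulE => /subr0_eq h1 /subr0_eq h2.
by rewrite h2 h1.
Qed.

End MaximizerCommutes.

(** * Stability of the maximizer and of the spectral gap *)

Section Stability.
Context {R : realType}.

Lemma frob_quad_split {l n} (P S : 'M[R]_l) (x : 'M[R]_(l, n)) :
  is_oproj P -> P *m S = S *m P ->
  frob x (S *m x) = frob (P *m x) (S *m (P *m x)) +
    frob ((1%:M - P) *m x) (S *m ((1%:M - P) *m x)).
Proof.
move=> hP PS; have hP' := is_oprojC hP; have [PT PP] := hP.
rewrite !frob_mulmxl (proj1 hP') PT.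
have -> : P *m (S *m (P *m x)) = P *m (S *m x) by rewrite (mulmxA S) -PS !mulmxA PP.
have -> : (1%:M - P) *m (S *m ((1%:M - P) *m x)) = (1%:M - P) *m (S *m x).
  rewrite (mulmxA S) (_ : S *m _ = (1%:M - P) *m S) ?mulmxA ?(proj2 hP') //.
  by rewrite !mxmulE PS.
by rewrite -frobDr -mulmxDl addrC subrK mul1mx.
Qed.

Lemma frob_mulmx_le {l n} (E : 'M[R]_l) (x : 'M[R]_(l, n)) : E^T = E ->
  frob (E *m x) (E *m x) <= l%:R ^+ 2 * `|E| ^+ 2 * frob x x.
Proof.
move=> ET; rewrite frob_mulmxl ET mulmxA.
apply: le_trans (ler_norm _) (le_trans (normr_quad_le _ _) _).
apply: ler_wpM2r; first exact: frob_ge0.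
by have := ler_wpM2l (ler0n R l) (normr_mulmx E E); lra.
Qed.

Lemma trmx_sub_oproj {l} (P Q : 'M[R]_l) : is_oproj P -> is_oproj Q ->
  (Q - P)^T = Q - P.
Proof. by move=> [PT _] [QT _]; rewrite linearB /= PT QT. Qed.

(** As [Q] does at least as well as [P] for [S], its deficit for [S0] is at most [<Q - P, S - S0>],
    linear in [Q - P], while Ky Fan bounds it below by a square. Dividing by [|Q - P|] gives the
    Lipschitz estimate. *)
Lemma oproj_perturb_bound {l} (P S0 S : 'M[R]_l) a b Q :
  spectral_gap P S0 a b -> b < a -> is_oproj Q -> \tr Q = \tr P ->
  \tr (P *m S) <= \tr (Q *m S) ->
  `|Q - P| <= 2 * (l * l)%:R / (a - b) * `|S - S0|.
Proof.
move=> gP ba hQ tQ PQ; have [hP _ _ _] := gP.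
have := ky_fan gP hQ tQ; have := sqr_normr_le_frob (Q - P).
have : \tr (P *m S0) - \tr (Q *m S0) <= frob (Q - P) (S - S0).
  rewrite /frob trmx_sub_oproj // !mxmulE !(mxtraceD, raddfN) /=.
  by lra.
have := le_trans (ler_norm _) (normr_frob_le (Q - P) (S - S0)).
set e := `|Q - P|; set K := `|S - S0|; set L := (l * l)%:R; set f := frob _ _.
set g := frob _ _ => h1 h2 h3 h4.
have ab : 0 < a - b by lra.
have e2 : (a - b) * e ^+ 2 <= 2 * L * K * e.
  by have := ler_wpM2l (ltW ab) h3; lra.
have [e0|e0] := leP e 0.
  apply: le_trans e0 _; apply: mulr_ge0; last exact: normr_ge0.
  by apply: divr_ge0; [apply: mulr_ge0|exact: ltW].
rewrite mulrAC ler_pdivlMr // mulrC -(ler_pM2r e0); lra.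
Qed.

(** With [E = Q - P], [(1 - P) x = E x] on the range of [Q] and [P x = - E x] on its kernel, so the
    forms change only by terms in [|E x|^2] and [K]. The three summands of the smallness condition
    bound [a |E x|^2], the form of [K] at [x] and the form of [S] at [E x]. *)
Lemma spectral_gap_perturb {l} (P S K : 'M[R]_l) a b Q (C : R) :
  spectral_gap P S a b -> 0 <= b -> b < a ->
  is_oproj Q -> Q *m (S + K) = (S + K) *m Q -> 0 <= C -> `|Q - P| <= C * `|K| ->
  `|K| <= 1 ->
  `|K| * (a * l%:R ^+ 2 * C ^+ 2 + l%:R + l%:R ^+ 3 * `|S| * C ^+ 2) <=
    (a - b) / 3 ->
  spectral_gap Q (S + K) (a - (a - b) / 3) (b + (a - b) / 3).
Proof.
move=> [hP PS ha hb] b0 ba hQ QS C0 hE K1 hK; have [QT QQ] := hQ.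
have [E EE] : exists E, E = Q - P by exists (Q - P).
have ET : E^T = E by rewrite EE trmx_sub_oproj.
(* [|K| <= 1] trades [|K|^2] for [|K|], which makes all the error terms linear in [|K|]. *)
have E2 : `|E| ^+ 2 <= C ^+ 2 * `|K|.
  rewrite -EE in hE; apply: (@le_trans _ _ ((C * `|K|) ^+ 2)).
    by rewrite lerXn2r ?nnegrE // mulr_ge0.
  by rewrite exprMn ler_wpM2l ?sqr_ge0 // expr2 ler_piMl.
have key n (x : 'M[R]_(l, n)) :
    `|frob x (K *m x)| <= l%:R * `|K| * frob x x /\
    frob (E *m x) (E *m x) <= l%:R ^+ 2 * (C ^+ 2 * `|K|) * frob x x.
  split; first exact: normr_quad_le.
  apply: le_trans (frob_mulmx_le x ET) _.
  by rewrite ler_wpM2r ?frob_ge0 // ler_wpM2l ?sqr_ge0.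
have hX n (x : 'M[R]_(l, n)) := ler_wpM2r (frob_ge0 x) hK.
have key' n (x : 'M[R]_(l, n)) : l%:R * `|S| * frob (E *m x) (E *m x) <=
    l%:R ^+ 3 * `|S| * C ^+ 2 * `|K| * frob x x.
  have [_ h] := key _ x; have := ler_wpM2l (mulr_ge0 (ler0n R l) (normr_ge0 S)) h.
  lra.
have a0 : 0 <= a by lra.
split=> // n W.
- have [x xE] : exists x, x = Q *m W by exists (Q *m W).
  have Ex : (1%:M - P) *m x = E *m x by rewrite xE EE !mxmulE QQ.
  rewrite -xE mulmxDl frobDr (frob_quad_split x hP PS).
  have [/ler_normlP[h1 _] h2] := key _ x.
  have := ha _ x; have := frob_oproj_split x hP; rewrite Ex.
  have /ler_normlP[h3 _] := normr_quad_le S (E *m x).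
  have h4 := key' _ x; have h5 := hX _ x; have h6 := ler_wpM2l a0 h2.
  move: h1 h3 h4 h5 h6.
  set X := frob x x; set N := frob (P *m x) (P *m x).
  set V := frob _ (K *m _); set M := frob (E *m x) (E *m x).
  set V1 := frob _ (S *m _); set V2 := frob _ (S *m _).
  move=> h1 h3 h4 h5 h6 e h7; have := congr1 ( *%R a) e; rewrite mulrDr; lra.
- have [x xE] : exists x, x = (1%:M - Q) *m W by exists ((1%:M - Q) *m W).
  have Ex : P *m x = - (E *m x) by rewrite xE EE !mxmulE QQ; mxlin.
  rewrite -xE mulmxDl frobDr (frob_quad_split x hP PS).
  have [/ler_normlP[_ h1] h2] := key _ x.
  have := hb _ x; have := frob_oproj_split x hP.
  rewrite Ex mulmxN !frobNl !frobNr !opprK.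
  have /ler_normlP[_ h3] := normr_quad_le S (E *m x).
  have h4 := key' _ x; have h5 := hX _ x; have h6 := frob_ge0 (E *m x).
  have h7 := ler_wpM2l b0 h6.
  have h8 : 0 <= a * l%:R ^+ 2 * C ^+ 2 * `|K| * frob x x.
    by rewrite !mulr_ge0 ?sqr_ge0 ?frob_ge0.
  move: h1 h3 h4 h5 h7 h8.
  set X := frob x x; set V := frob _ (K *m _); set M := frob (E *m x) (E *m x).
  set V1 := frob _ (S *m _); set V2 := frob _ (S *m _); set N := frob _ _.
  move=> h1 h3 h4 h5 h7 h8 e h9; have := congr1 ( *%R b) e; rewrite mulrDr; lra.
Qed.

End Stability.

(** * Calculus of remainders *)

Section Order.
Context {R : realType} {l m : nat} (D : set 'M[R]_(l, m)).

(** Big O of [|H|^d] with one constant on the whole set [D], in practice a ball about 0, so that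
    orders add under products. *)
Definition of_order {p q} (d : nat) (F : 'M[R]_(l, m) -> 'M[R]_(p, q)) :=
  exists2 C : R, 0 <= C & forall H, D H -> `|F H| <= C * `|H| ^+ d.

Lemma of_orderD {p q d} (F G : _ -> 'M[R]_(p, q)) :
  of_order d F -> of_order d G -> of_order d (fun H => F H + G H).
Proof.
move=> [C C0 hF] [C' C0' hG]; exists (C + C') => [|H DH]; first exact: addr_ge0.
by rewrite mulrDl (le_trans (ler_normD _ _)) // lerD ?hF ?hG.
Qed.

Lemma eq_of_order {p q d} (F G : _ -> 'M[R]_(p, q)) :
  (forall H, D H -> F H = G H) -> of_order d G -> of_order d F.
Proof. by move=> FG [C C0 hG]; exists C => // H DH; rewrite FG ?hG. Qed.

Lemma of_orderN {p q d} (F : _ -> 'M[R]_(p, q)) :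
  of_order d F -> of_order d (fun H => - F H).
Proof. by move=> [C C0 hF]; exists C => // H DH; rewrite normrN hF. Qed.

Lemma of_orderB {p q d} (F G : _ -> 'M[R]_(p, q)) :
  of_order d F -> of_order d G -> of_order d (fun H => F H - G H).
Proof. by move=> hF hG; apply/of_orderD/of_orderN. Qed.

Lemma of_orderM {p q s} d d' (F : _ -> 'M[R]_(p, q)) (G : _ -> 'M[R]_(q, s)) :
  of_order d F -> of_order d' G -> of_order (d + d') (fun H => F H *m G H).
Proof.
move=> [C C0 hF] [C' C0' hG]; exists (q%:R * (C * C')) => [|H DH].
  by rewrite !mulr_ge0.
rewrite (le_trans (normr_mulmx _ _)) // -mulrA ler_wpM2l // exprD mulrACA.
by rewrite ler_pM // ?hF ?hG.
Qed.

Lemma of_order_cst {p q} (A : 'M[R]_(p, q)) : of_order 0 (fun _ => A).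
Proof. by exists `|A| => // H _; rewrite expr0 mulr1. Qed.

Lemma of_order_id : of_order 1 id.
Proof. by exists 1 => // H _; rewrite expr1 mul1r. Qed.

Lemma of_order_tr {p q d} (F : _ -> 'M[R]_(p, q)) :
  of_order d F -> of_order d (fun H => (F H)^T).
Proof.
by move=> [C C0 hF]; exists C => // H DH; rewrite (le_trans (normr_trmx _)) // hF.
Qed.

Lemma of_orderMl {p q s} d (B : 'M[R]_(p, q)) (F : _ -> 'M[R]_(q, s)) :
  of_order d F -> of_order d (fun H => B *m F H).
Proof. exact: (of_orderM (of_order_cst B)). Qed.

Lemma of_orderMr {p q s} d (F : _ -> 'M[R]_(p, q)) (B : 'M[R]_(q, s)) :
  of_order d F -> of_order d (fun H => F H *m B).
Proof. by rewrite -{2}(addn0 d) => hF; apply: of_orderM hF (of_order_cst B). Qed.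

Lemma of_order_sum {p q d} (I : Type) (s : seq I) (Pr : pred I) (F : I -> _ -> 'M[R]_(p, q)) :
  (forall i, of_order d (F i)) -> of_order d (fun H => \sum_(i <- s | Pr i) F i H).
Proof.
move=> hF; elim: s => [|i s IH].
  by exists 0 => // H _; rewrite big_nil normr0 mul0r.
case: (boolP (Pr i)) => Pi; last by under eq_fun do rewrite big_cons (negbTE Pi).
by under eq_fun do rewrite big_cons Pi; apply: of_orderD.
Qed.

Lemma of_order_leq {p q} d d' (F : _ -> 'M[R]_(p, q)) :
  (forall H, D H -> `|H| <= 1) -> (d <= d')%N -> of_order d' F -> of_order d F.
Proof.
move=> D1 dd [C C0 hF]; exists C => // H DH; rewrite (le_trans (hF H DH)) //.
by rewrite ler_wpM2l // ler_wiXn2l ?D1.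
Qed.

End Order.

(** * The nearest point near A as a projection applied to A + H *)

Section LocalProjection.
Context {R : realType}.

Lemma rank_proj_local {l m} r (A : 'M[R]_(l, m)) P a b :
  spectral_gap P (A *m A^T) a b -> 0 <= b -> b < a -> \tr P = r%:R ->
  exists (Pi : 'M[R]_(l, m) -> 'M[R]_l) (d : R),
  [/\ 0 < d <= 1,
      forall H, `|H| <= d -> is_oproj (Pi H),
      forall H, `|H| <= d ->
        Pi H *m ((A + H) *m (A + H)^T) = (A + H) *m (A + H)^T *m Pi H,
      forall H, `|H| <= d -> rank_proj r (A + H) = Pi H *m (A + H)
    & of_order [set H | `|H| <= d] 1 (fun H => Pi H - P)].
Proof.
move=> gP b0 ba tP; have [hP _ _ _] := gP.
(* A maximizer is chosen for each [H] separately; its closeness to [P] comes afterwards from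
   [hE]. *)
have [Pi hPi] := choice (fun H => max_oproj ((A + H) *m (A + H)^T) hP).
pose K (H : 'M[R]_(l, m)) := A *m H^T + H *m A^T + H *m H^T.
have SK H : (A + H) *m (A + H)^T = A *m A^T + K H.
  by rewrite linearD /= /K !mxmulE; mxlin.
have comm H : Pi H *m ((A + H) *m (A + H)^T) = (A + H) *m (A + H)^T *m Pi H.
  have [hQ tQ max] := hPi H; apply: max_oproj_comm => //.
    by rewrite trmx_mul trmxK.
  by rewrite tQ.
have [C1 C10 hK] : of_order [set H | `|H| <= 1] 1 K.
  apply: of_orderD; first apply: of_orderD.
  - exact/of_orderMl/of_order_tr/of_order_id.
  - exact/of_orderMr/of_order_id.
  - apply: (@of_order_leq _ _ _ _ _ _ 1 2) => //.
    by apply: (@of_orderM _ _ _ _ _ _ _ 1 1); [|apply: of_order_tr]; exact: of_order_id.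
pose C := 2 * (l * l)%:R / (a - b) : R.
have ab : 0 < a - b by rewrite subr_gt0.
have C0 : 0 <= C by rewrite divr_ge0 ?(ltW ab) ?mulr_ge0.
have hE H : `|Pi H - P| <= C * `|K H|.
  have [hQ tQ max] := hPi H.
  have -> : K H = (A + H) *m (A + H)^T - A *m A^T by rewrite SK addrC addKr.
  by apply: (@oproj_perturb_bound _ _ _ _ _ _ _ _ gP) => //; exact: max.
(* The factor of [|K|] in the smallness condition of [spectral_gap_perturb]. *)
pose c := a * l%:R ^+ 2 * C ^+ 2 + l%:R + l%:R ^+ 3 * `|A *m A^T| * C ^+ 2.
have a0 : 0 <= a by exact: le_trans (ltW ba).
have c0 : 0 <= c.
  by rewrite /c !(addr_ge0, mulr_ge0, exprn_ge0, ler0n) ?invr_ge0 ?(ltW ab).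
(* On the ball of radius [B^-1], [|K H| (1 + 3 c / (a - b)) <= 1], which gives both [|K H| <= 1] and
   [c |K H| <= (a - b) / 3]. The final [+ 1] keeps the radius at most 1, where the estimate of [K]
   holds. *)
pose B := C1 * (1 + c * 3 / (a - b)) + 1.
have B1 : 1 <= B by rewrite lerDr mulr_ge0 // addr_ge0 // divr_ge0 ?(ltW ab) ?mulr_ge0.
have B0 : 0 < B by exact: lt_le_trans B1.
have d1 : B^-1 <= 1 by rewrite invf_le1.
have D1 (H : 'M[R]_(l, m)) : `|H| <= B^-1 -> `|H| <= 1 by move=> /le_trans; apply.
have Kd (H : 'M[R]_(l, m)) : `|H| <= B^-1 -> `|K H| * (1 + c * 3 / (a - b)) <= 1.
  move=> Hd; have := hK H (D1 H Hd); rewrite expr1 => hKH.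
  have e0 : 0 <= 1 + c * 3 / (a - b) by rewrite addr_ge0 // divr_ge0 ?(ltW ab) ?mulr_ge0.
  apply: le_trans (ler_wpM2r e0 hKH) _.
  have : B * `|H| <= 1 by rewrite -ler_pdivlMl // mulr1.
  by rewrite /B; have := normr_ge0 H; lra.
exists Pi, B^-1; split.
- by rewrite invr_gt0 B0 d1.
- by move=> H _; have [] := hPi H.
- by move=> H _; exact: comm.
- move=> H Hd; have [hQ tQ max] := hPi H.
  have e0 : 0 <= c * 3 / (a - b) by rewrite divr_ge0 ?(ltW ab) ?mulr_ge0.
  have KK := Kd H Hd; have K0 := normr_ge0 (K H).
  have KE := mulr_ge0 K0 e0.
  (* Each end of the gap moves by a third of its width, so a third of it remains. *)
  apply: (@eckart_young _ _ _ _ _ _ (a - (a - b) / 3) (b + (a - b) / 3)).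
  + rewrite SK; apply: (@spectral_gap_perturb _ _ _ _ _ _ _ _ C gP) => //.
    * by rewrite -SK comm.
    * by rewrite mulrDr mulr1 in KK; lra.
    * rewrite -/c.
      have : `|K H| * (c * 3 / (a - b)) <= 1 by rewrite mulrDr mulr1 in KK; lra.
      rewrite mulrA ler_pdivrMr // mul1r; lra.
  + lra.
  + lra.
  + by rewrite tQ.
- exists (C * C1) => [|H Hd]; first exact: mulr_ge0.
  rewrite -mulrA (le_trans (hE H)) // ler_wpM2l // hK //; exact: D1.
Qed.

End LocalProjection.

(** * Orthonormal families and the projections they span *)

Section Orthonormal.
Context {R : realType} {l n : nat} (u : nat -> 'cV[R]_l).
Hypothesis orth_u : forall i j, (1 <= i <= n)%N -> (1 <= j <= n)%N ->
  (u i)^T *m u j = (i == j)%:R%:M.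

Lemma orth_sum {p} a b i (y : nat -> 'M[R]_(1, p)) :
  (1 <= a)%N -> (b <= n.+1)%N -> (1 <= i <= n)%N ->
  (u i)^T *m (\sum_(a <= j < b) u j *m y j) = if (a <= i < b)%N then y i else 0.
Proof.
move=> a1 bn hi; rewrite mulmx_sumr.
have e j : j \in index_iota a b -> (u i)^T *m (u j *m y j) = (i == j)%:R *: y j.
  rewrite mem_index_iota => /andP[aj jb]; rewrite mulmxA orth_u ?mul_scalar_mx //.
  by rewrite (leq_trans a1 aj) -ltnS (leq_trans jb bn).
rewrite big_seq (eq_bigr _ e) -big_seq.
case: ifPn => hab.
  rewrite (bigD1_seq i) ?mem_index_iota ?iota_uniq //= eqxx scale1r big1 ?addr0 //.
  by move=> j /negbTE ji; rewrite eq_sym ji scale0r.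
rewrite big_seq big1 // => j; rewrite mem_index_iota => jab.
by case: eqP => [ij|_]; [rewrite ij jab in hab|rewrite scale0r].
Qed.

Definition proj_sum a b : 'M[R]_l := \sum_(a <= j < b) u j *m (u j)^T.

Lemma proj_sum_tr a b : (proj_sum a b)^T = proj_sum a b.
Proof.
by rewrite /proj_sum raddf_sum /=; apply: eq_bigr => j _; rewrite trmx_mul trmxK.
Qed.

Lemma orth_proj_sum a b i : (1 <= a)%N -> (b <= n.+1)%N -> (1 <= i <= n)%N ->
  (u i)^T *m proj_sum a b = if (a <= i < b)%N then (u i)^T else 0.
Proof. by move=> a1 bn hi; rewrite orth_sum. Qed.

Lemma proj_sum_orth a b i : (1 <= a)%N -> (b <= n.+1)%N -> (1 <= i <= n)%N ->
  proj_sum a b *m u i = if (a <= i < b)%N then u i else 0.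
Proof.
move=> a1 bn hi; apply: trmx_inj; rewrite trmx_mul proj_sum_tr orth_proj_sum //.
by case: ifP => //; rewrite trmx0.
Qed.

(** Congruence that hands each term, besides its own range, the range where the family is
    orthonormal. *)
Lemma eq_sum_orth a b {V : nmodType} (F G : nat -> V) :
  (1 <= a)%N -> (b <= n.+1)%N ->
  (forall i, (a <= i < b)%N -> (1 <= i <= n)%N -> F i = G i) ->
  \sum_(a <= i < b) F i = \sum_(a <= i < b) G i.
Proof.
move=> a1 bn FG; apply: eq_big_nat => i /andP[ai ib]; apply: FG; first by rewrite ai.
by rewrite (leq_trans a1 ai) -ltnS (leq_trans ib bn).
Qed.

Lemma is_oproj_proj_sum a b : (1 <= a)%N -> (b <= n.+1)%N -> is_oproj (proj_sum a b).
Proof.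
move=> a1 bn; split; first exact: proj_sum_tr.
rewrite {1 3}/proj_sum mulmx_suml; apply: eq_sum_orth => // i hi hi'.
by rewrite -mulmxA orth_proj_sum // hi.
Qed.

Lemma mxtrace_proj_sum a b : (1 <= a)%N -> (b <= n.+1)%N ->
  \tr (proj_sum a b) = (b - a)%:R.
Proof.
move=> a1 bn; rewrite raddf_sum /= -sumr_const_nat; apply: eq_sum_orth => // i _ hi.
by rewrite mxtrace_mulC orth_u // eqxx mxtrace1.
Qed.

Lemma frob_weighted_sum {p} a b (c : nat -> R) (W : 'M[R]_(l, p)) :
  frob W ((\sum_(a <= j < b) c j *: (u j *m (u j)^T)) *m W) =
  \sum_(a <= j < b) c j * frob ((u j)^T *m W) ((u j)^T *m W).
Proof.
rewrite /frob mulmx_suml mulmx_sumr raddf_sum /=; apply: eq_bigr => j _.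
rewrite -scalemxAl -scalemxAr mxtraceZ; congr (_ * _).
by rewrite trmx_mul trmxK !mulmxA.
Qed.

End Orthonormal.

(** * Action of A and of its Gram matrix on singular vectors *)

Section SingularValues.
Context {R : realType} {l m n : nat} (A : 'M[R]_(l, m)).
Variables (sigma : nat -> R) (u : nat -> 'cV[R]_l) (v : nat -> 'cV[R]_m).
Hypothesis svdA : is_svd n A sigma u v.

Let orth_u : forall i j, (1 <= i <= n)%N -> (1 <= j <= n)%N ->
  (u i)^T *m u j = (i == j)%:R%:M.
Proof. by case: svdA. Qed.

Let orth_v : forall i j, (1 <= i <= n)%N -> (1 <= j <= n)%N ->
  (v i)^T *m v j = (i == j)%:R%:M.
Proof. by case: svdA. Qed.

Lemma svdE : A = \sum_(1 <= j < n.+1) u j *m (sigma j *: (v j)^T).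
Proof.
by case: svdA => _ _ _ _ {1}->; apply: eq_bigr => j _; rewrite -scalemxAr.
Qed.

Lemma svd_left i : (1 <= i <= n)%N -> (u i)^T *m A = sigma i *: (v i)^T.
Proof. by move=> hi; rewrite svdE (orth_sum orth_u) // ltnS hi. Qed.

Lemma svd_trE : A^T = \sum_(1 <= j < n.+1) v j *m (sigma j *: (u j)^T).
Proof.
case: svdA => _ _ _ _ {1}->; rewrite raddf_sum; apply: eq_bigr => j _ /=.
by rewrite linearZ /= trmx_mul trmxK scalemxAr.
Qed.

Lemma svd_right i : (1 <= i <= n)%N -> A *m v i = sigma i *: u i.
Proof.
move=> hi; apply: trmx_inj; rewrite trmx_mul svd_trE (orth_sum orth_v) // ltnS hi.
by rewrite linearZ.
Qed.

Lemma svd_tr_right i : (1 <= i <= n)%N -> A^T *m u i = sigma i *: v i.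
Proof.
by move=> hi; apply: trmx_inj; rewrite trmx_mul trmxK svd_left // linearZ.
Qed.

Lemma svd_gramE : A *m A^T = \sum_(1 <= j < n.+1) sigma j ^+ 2 *: (u j *m (u j)^T).
Proof.
rewrite svd_trE mulmx_sumr; apply: (@eq_sum_orth n) => // j _ hj.
by rewrite mulmxA svd_right // -scalemxAl -scalemxAr scalerA.
Qed.

Lemma svd_gram_left i : (1 <= i <= n)%N ->
  (u i)^T *m (A *m A^T) = sigma i ^+ 2 *: (u i)^T.
Proof.
move=> hi; rewrite svd_gramE (eq_bigr (fun j => u j *m (sigma j ^+ 2 *: (u j)^T))).
  by rewrite (orth_sum orth_u) // ltnS hi.
by move=> j _; rewrite -scalemxAr.
Qed.

Lemma svd_gram_right i : (1 <= i <= n)%N ->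
  A *m A^T *m u i = sigma i ^+ 2 *: u i.
Proof.
move=> hi; apply: trmx_inj; rewrite trmx_mul !trmx_mul trmxK svd_gram_left //.
by rewrite linearZ.
Qed.

Section Gap.
Variable r : nat.
Hypothesis rn : (r <= n)%N.
Let P := proj_sum u 1 r.+1.

Lemma proj_sum_gram :
  P *m (A *m A^T) = \sum_(1 <= j < r.+1) sigma j ^+ 2 *: (u j *m (u j)^T).
Proof.
rewrite mulmx_suml; apply: (@eq_sum_orth n) => // i _ hi.
by rewrite -mulmxA svd_gram_left // -scalemxAr.
Qed.

Lemma proj_sum_gram_comm : P *m (A *m A^T) = A *m A^T *m P.
Proof.
rewrite proj_sum_gram mulmx_sumr; apply: (@eq_sum_orth n) => // i _ hi.
by rewrite mulmxA svd_gram_right // -scalemxAl.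
Qed.

Lemma proj_sum_compl_gram :
  (1%:M - P) *m (A *m A^T) =
  \sum_(r.+1 <= j < n.+1) sigma j ^+ 2 *: (u j *m (u j)^T).
Proof.
rewrite mulmxBl mul1mx proj_sum_gram svd_gramE (@big_cat_nat _ _ _ r.+1) //=.
by rewrite addrAC subrr add0r.
Qed.

Lemma proj_sum_svd :
  P *m A = \sum_(1 <= i < r.+1) sigma i *: (u i *m (v i)^T).
Proof.
rewrite mulmx_suml; apply: (@eq_sum_orth n) => // i _ hi.
by rewrite -mulmxA svd_left // -scalemxAr.
Qed.

(** Both [P S] and [(1 - P) S] are weighted sums of the [u j (u j)^T], so the forms are compared
    weight by weight. *)
Lemma svd_spectral_gap (b : R) : (0 < r)%N -> 0 <= b ->
  (forall j, (r < j <= n)%N -> sigma j ^+ 2 <= b) ->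
  spectral_gap P (A *m A^T) (sigma r ^+ 2) b.
Proof.
move=> r0 b0 hb; have hP := @is_oproj_proj_sum _ _ _ _ orth_u 1 r.+1 isT rn.
have hP' := is_oprojC hP; have [PT PP] := hP; have [PT' PP'] := hP'.
have [_ _ s0 sdec _] := svdA.
split => // [|p W|p W]; first exact: proj_sum_gram_comm.
- rewrite frob_oproj // {1}frob_mulmxl PT.
  have -> : P *m (A *m A^T *m (P *m W)) = P *m (A *m A^T) *m W.
    by rewrite (mulmxA _ P) -proj_sum_gram_comm !mulmxA PP.
  rewrite proj_sum_gram.
  have -> : P = \sum_(1 <= j < r.+1) 1 *: (u j *m (u j)^T).
    by apply: eq_bigr => j _; rewrite scale1r.
  rewrite !frob_weighted_sum mulr_sumr [leLHS]big_nat [leRHS]big_nat.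
  apply: ler_sum => i /andP[i1 ir]; rewrite mul1r ler_wpM2r ?frob_ge0 //.
  by rewrite lerXn2r ?nnegrE ?s0 ?sdec ?r0 ?rn ?i1 ?(leq_trans _ rn).
- rewrite frob_mulmxl PT'.
  have -> : (1%:M - P) *m (A *m A^T *m ((1%:M - P) *m W)) =
            (1%:M - P) *m (A *m A^T) *m ((1%:M - P) *m W).
    by rewrite !mulmxA.
  have hP2 := @is_oproj_proj_sum _ _ _ _ orth_u r.+1 n.+1 isT (leqnn _).
  set Y := (1%:M - P) *m W.
  have YE : frob W ((1%:M - P) *m (A *m A^T) *m Y) =
            frob Y ((1%:M - P) *m (A *m A^T) *m Y).
    rewrite [RHS]frob_mulmxl PT' !mulmxA PP'. by [].
  rewrite YE proj_sum_compl_gram frob_weighted_sum.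
  (* The vectors [u j] with [j > r] may span only part of the kernel of [P]. The form vanishes in
     the missing directions, and [b >= 0] lets their norm be added on the right. *)
  apply: (@le_trans _ _ (b * frob (proj_sum u r.+1 n.+1 *m Y) (proj_sum u r.+1 n.+1 *m Y))).
    rewrite frob_oproj //.
    have -> : proj_sum u r.+1 n.+1 = \sum_(r.+1 <= j < n.+1) 1 *: (u j *m (u j)^T).
      by apply: eq_bigr => j _; rewrite scale1r.
    rewrite frob_weighted_sum mulr_sumr [leLHS]big_nat [leRHS]big_nat.
    by apply: ler_sum => i hi; rewrite mul1r ler_wpM2r ?frob_ge0 // hb.
  apply: ler_wpM2l => //; rewrite [leRHS](frob_oproj_split Y hP2).
  by rewrite lerDl frob_ge0.
Qed.

End Gap.
End SingularValues.

(** * Second order expansion of the projection at A *)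

Section Expansion.
Context {R : realType} {l m n : nat} (r : nat) (A : 'M[R]_(l, m)).
Variables (sigma : nat -> R) (u : nat -> 'cV[R]_l) (v : nat -> 'cV[R]_m).
Hypothesis svdA : is_svd n A sigma u v.
Hypotheses (r0 : (0 < r)%N) (rn : (r <= n)%N) (sigma_r : 0 < sigma r).
Hypothesis sigma_gap : forall j, (r < j <= n)%N -> sigma j < sigma r.

Let orth_u : forall i j, (1 <= i <= n)%N -> (1 <= j <= n)%N ->
  (u i)^T *m u j = (i == j)%:R%:M.
Proof. by case: svdA. Qed.

Let P := proj_sum u 1 r.+1.
Let Q := 1%:M - P.
Let S := A *m A^T.

Let hP : is_oproj P. Proof. exact: (is_oproj_proj_sum orth_u). Qed.

Lemma sigma_gt0 i : (1 <= i <= r)%N -> 0 < sigma i.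
Proof.
case/andP=> i1 ir; have [_ _ _ sdec _] := svdA.
exact: lt_le_trans sigma_r (sdec _ _ i1 ir rn).
Qed.

Let sigma_lt i j : (1 <= i <= r)%N -> (r < j <= n)%N -> sigma j < sigma i.
Proof.
case/andP=> i1 ir hj; have [_ _ _ sdec _] := svdA.
exact: lt_le_trans (sigma_gap hj) (sdec _ _ i1 ir rn).
Qed.

Let sigma_ge0 j : (r < j <= n)%N -> 0 <= sigma j.
Proof. by case/andP=> rj jn; case: svdA => _ _ -> //; rewrite (leq_ltn_trans _ rj). Qed.

Lemma sqr_sigma_lt i j : (1 <= i <= r)%N -> (r < j <= n)%N ->
  sigma j ^+ 2 < sigma i ^+ 2.
Proof.
by move=> hi hj; rewrite ltrXn2r ?nnegrE ?sigma_ge0 ?(ltW (sigma_gt0 hi)) ?sigma_lt.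
Qed.

Lemma svd_truncation_gap : exists2 b : R, 0 <= b < sigma r ^+ 2 &
  spectral_gap P S (sigma r ^+ 2) b.
Proof.
have hr : (1 <= r <= r)%N by rewrite r0 /=.
(* For [r = n] no singular value follows and [S] vanishes on the kernel of [P], whence [b = 0]. This
   case serves at points of the manifold. *)
have [rn'|nr] := ltnP r n; [exists (sigma r.+1 ^+ 2)|exists 0].
- by rewrite sqr_ge0 sqr_sigma_lt // ltnSn.
- apply: (svd_spectral_gap svdA) => //; first exact: sqr_ge0.
  move=> j /andP[rj jn]; have [_ _ s0 sdec _] := svdA.
  by rewrite lerXn2r ?nnegrE ?s0 ?sdec ?(leq_ltn_trans _ rj).
- by rewrite lexx exprn_gt0.
- apply: (svd_spectral_gap svdA) => // j /andP[rj jn].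
  by have := leq_trans rj jn; rewrite ltnNge nr.
Qed.

Lemma mxtrace_svd_proj : \tr P = r%:R.
Proof. by rewrite (mxtrace_proj_sum orth_u) // subSS subn0. Qed.

Lemma rank_proj_svd : rank_proj r A = P *m A.
Proof.
have [b /andP[b0 br] gP] := svd_truncation_gap.
by apply: (eckart_young gP) => //; [exact: le_lt_trans br|exact: mxtrace_svd_proj].
Qed.

(* [sylv i] inverts [sigma i ^+ 2 - S] on the kernel of [P]. *)
Definition sylv i : 'M[R]_l := (sigma i ^+ 2)^-1 *: (Q +
  \sum_(r.+1 <= j < n.+1)
    (sigma j ^+ 2 / (sigma i ^+ 2 - sigma j ^+ 2)) *: (u j *m (u j)^T)).

(** On [u j] with [j > r], the factor [(1 + sigma j ^+ 2 / (sigma i ^+ 2 - sigma j ^+ 2)) / sigma i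
    ^+ 2] is the inverse of [sigma i ^+ 2 - sigma j ^+ 2]; on the rest of the kernel of [P], [S]
    vanishes. *)
Lemma sylvP i : (1 <= i <= r)%N -> sigma i ^+ 2 *: sylv i - sylv i *m S = Q.
Proof.
move=> hi; have si0 : sigma i ^+ 2 != 0 by rewrite sqrf_eq0 gt_eqF // sigma_gt0.
rewrite /sylv scalerA mulfV // scale1r -scalemxAl mulmxDl.
rewrite (proj_sum_compl_gram svdA) // mulmx_suml -big_split scaler_sumr /=.
rewrite -addrA -sumrB big1_seq ?addr0 // => j; rewrite mem_index_iota ltnS => /andP[_ hj].
have hj' : (1 <= j <= n)%N by case/andP: hj => rj ->; rewrite (leq_ltn_trans _ rj).
rewrite -scalemxAl -mulmxA (svd_gram_left svdA) // -scalemxAr scalerA -scalerDl.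
rewrite scalerA -scalerBl; apply/eqP; rewrite scaler_eq0; apply/orP; left.
have := sqr_sigma_lt hi hj; rewrite -subr_gt0 => /lt0r_neq0 h.
by apply/eqP; field; rewrite h (lt0r_neq0 (sigma_gt0 hi)).
Qed.

Lemma sylv_compl i : sylv i *m Q = sylv i.
Proof.
rewrite /sylv -scalemxAl mulmxDl (proj2 (is_oprojC hP)) mulmx_suml.
congr (_ *: (_ + _)); apply: (eq_sum_orth (n := n)) => // j /andP[rj jn] hj.
rewrite -scalemxAl -mulmxA mulmxBr mulmx1 (orth_proj_sum orth_u) //.
by rewrite ltnS [(j <= r)%N]leqNgt rj andbF subr0.
Qed.

(** The solution [X = Q X P] of the Sylvester equation [X S - S X = Q M P], built from its values on
    the eigenvectors [u i] of [S]. *)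
Definition sylv_sol (M : 'M[R]_l) : 'M[R]_l :=
  \sum_(1 <= i < r.+1) sylv i *m M *m (u i *m (u i)^T).

Lemma sylv_solD M N : sylv_sol (M + N) = sylv_sol M + sylv_sol N.
Proof.
by rewrite -big_split; apply: eq_bigr => i _; rewrite mulmxDr mulmxDl.
Qed.

(** Applied to [u i] the equation reads [(sigma i ^+ 2 - S) X u_i = Q M u_i], where [sylv i] inverts
    the left factor. [X P = X] recovers [X] from the [X u_i]. *)
Lemma sylv_sol_uniq X M : Q *m X = X -> X *m P = X ->
  X *m S - S *m X = Q *m M *m P -> X = sylv_sol M.
Proof.
move=> QX XP XS; rewrite -{1}XP mulmx_sumr.
apply: (eq_sum_orth (n := n)) => // i /andP[i1 ir] hi.
rewrite !mulmxA; congr (_ *m _).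
have Pu : P *m u i = u i by rewrite (proj_sum_orth orth_u) // i1 ir.
transitivity (sylv i *m (Q *m M *m P) *m u i); last first.
  by rewrite -!mulmxA Pu (mulmxA _ Q) sylv_compl.
have hi' : (1 <= i <= r)%N by rewrite i1 -ltnS.
have Su : S *m u i = sigma i ^+ 2 *: u i by rewrite (svd_gram_right svdA).
rewrite -XS mulmxBr mulmxBl -!mulmxA (mulmxA A) Su -!scalemxAr.
rewrite -[X in X *m _ = _]QX -(sylvP hi') mulmxBl -scalemxAl !mulmxBl -scalemxAl.
by rewrite !mulmxA.
Qed.



(** Idempotence gives [E E = E - P E - E P]; hence [P E P = - P E E P] and [Q E Q = Q E E Q], so the
    diagonal blocks are of second order. *)
Lemma oproj_diff_split (E : 'M[R]_l) : is_oproj (P + E) ->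
  E = Q *m E *m P + P *m E *m Q - P *m (E *m E) *m P + Q *m (E *m E) *m Q.
Proof.
have [_ PP] := hP; move=> [_ h]; rewrite !mxmulE PP in h.
have -> : E *m E = E - P *m E - E *m P.
  by move/matrixP: h => h; apply/matrixP => i j; move: (h i j); rewrite !mxlinE; lra.
by rewrite /Q !mxmulE !(PP, oprojK _ hP); mxlin.
Qed.

(** The product rule for [Pi (A + H)]: the first order part of [E] is a Sylvester solution plus its
    transpose. *)
Definition proj_diff (H : 'M[R]_(l, m)) : 'M[R]_(l, m) :=
  (sylv_sol (A *m H^T + H *m A^T) + (sylv_sol (A *m H^T + H *m A^T))^T) *m A + P *m H.

(** An exact identity. Commutation makes [Q E P] the Sylvester solution for [K + N]; once
    [E = O(H)], every term of [N] has two factors of first order, and so has every term on the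
    right. *)
Lemma proj_remainder (E : 'M[R]_l) (H : 'M[R]_(l, m)) (K : 'M[R]_l) :
  is_oproj (P + E) -> K = A *m H^T + H *m A^T ->
  (P + E) *m ((A + H) *m (A + H)^T) = (A + H) *m (A + H)^T *m (P + E) ->
  let N := H *m H^T + ((K + H *m H^T) *m E - E *m (K + H *m H^T)) in
  (P + E) *m (A + H) - P *m A - proj_diff H =
  E *m H + (sylv_sol N + (sylv_sol N)^T - P *m (E *m E) *m P + Q *m (E *m E) *m Q) *m A.
Proof.
move=> hE KE; have [PT PP] := hP; rewrite /proj_diff -KE.
have -> : (A + H) *m (A + H)^T = S + (K + H *m H^T).
  by rewrite linearD /= KE /S; mxlin.
have PS : P *m S = S *m P by exact: (proj_sum_gram_comm svdA rn).
have hQ := is_oprojC hP; have [QT QQ] := hQ.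
have ET : E^T = E by have := trmx_sub_oproj hP hE; rewrite addrC addKr.
set J := K + _ => comm /=; set N := H *m H^T + _.
have QEP : Q *m E *m P = sylv_sol (K + N).
  apply: sylv_sol_uniq; [by rewrite !mulmxA QQ|by rewrite -mulmxA PP|].
  have -> : K + N = J + (J *m E - E *m J) by rewrite /N addrA.
  move: (S) PS comm => T PT' comm.
  have ETT : E *m T = T *m E + T *m P - P *m T + J *m (P + E) - (P + E) *m J.
    move/matrixP: comm => h; apply/matrixP => i j; move: (h i j).
    by rewrite !mxmulE !mxlinE; lra.
  rewrite -(mulmxA _ P) PT' !mulmxA -[Q *m E *m T]mulmxA ETT.
  by rewrite -PT' /Q !mxmulE !(PP, PT', oprojK _ hP) -?(mulmxA _ P T); mxlin.
have EE : E = sylv_sol K + sylv_sol N + (sylv_sol K + sylv_sol N)^T -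
    P *m (E *m E) *m P + Q *m (E *m E) *m Q.
  rewrite {1}(oproj_diff_split hE) -sylv_solD -QEP; congr (_ + _ - _ + _).
  by rewrite !trmx_mul PT QT ET mulmxA.
rewrite [in LHS]mulmxDl !mulmxDr {1}EE raddfD /=.
by mxlin.
Qed.

Lemma of_order_sylv_sol D d (F : 'M[R]_(l, m) -> 'M[R]_l) :
  of_order D d F -> of_order D d (fun H => sylv_sol (F H)).
Proof. by move=> hF; apply: of_order_sum => i; apply/of_orderMr/of_orderMl. Qed.

Lemma rank_proj_expansion : exists2 d : R, 0 < d &
  of_order [set H | `|H| <= d] 2
    (fun H => rank_proj r (A + H) - rank_proj r A - proj_diff H).
Proof.
have [b /andP[b0 br] gP] := svd_truncation_gap.
have [Pi [d [/andP[d0 d1] hPi comm rE oE]]] := rank_proj_local gP b0 br mxtrace_svd_proj.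
exists d => //; set D := [set H | _] in oE *.
have D1 H : D H -> `|H| <= 1 by move/le_trans; apply.
pose E H := Pi H - P.
have PiE H : P + E H = Pi H by rewrite addrC subrK.
pose K H := A *m H^T + H *m A^T.
pose N H := H *m H^T + ((K H + H *m H^T) *m E H - E H *m (K H + H *m H^T)).
apply: (@eq_of_order _ _ _ _ _ _ _ _ (fun H => E H *m H + (sylv_sol (N H) +
  (sylv_sol (N H))^T - P *m (E H *m E H) *m P + Q *m (E H *m E H) *m Q) *m A)).
  move=> H DH; rewrite rE // rank_proj_svd -PiE; apply: proj_remainder => //.
    by rewrite PiE; exact: hPi.
  by rewrite PiE; exact: comm.
have o1 := @of_order_id R l m D.
have oHH : of_order D 2 (fun H => H *m H^T).
  exact: (of_orderM o1 (of_order_tr o1)).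
have oK : of_order D 1 (fun H => K H + H *m H^T).
  apply: of_orderD; last exact: (of_order_leq D1 _ oHH).
  by apply: of_orderD; [apply/of_orderMl/of_order_tr|apply: of_orderMr].
have oEE := of_orderM oE oE.
have oN : of_order D 2 N.
  by apply: of_orderD => //; apply: of_orderB;
    [exact: (of_orderM oK oE)|exact: (of_orderM oE oK)].
have oG := of_order_sylv_sol oN.
apply: of_orderD; first exact: (of_orderM oE o1).
apply: of_orderMr; apply: of_orderD; last by apply: of_orderMr; apply: of_orderMl.
apply: of_orderB; last by apply: of_orderMr; apply: of_orderMl.
by apply: of_orderD => //; apply: of_order_tr.
Qed.

End Expansion.

(** * From a quadratic remainder to the differential *)

Section Differentiability.
Context {R : realType} {l m p q : nat}.

Lemma linear_mx_continuous (L : {linear 'M[R]_(l, m) -> 'M[R]_(p, q)}) :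
  continuous L.
Proof.
apply/linear_bounded_continuous/ex_bound.
exists (\sum_i \sum_j `|L (delta_mx i j)|).
near=> H => /=.
rewrite [in leLHS](matrix_sum_delta H) linear_sum /=.
rewrite (le_trans (ler_norm_sum _ _ _)) //; apply: ler_sum => i _.
rewrite linear_sum (le_trans (ler_norm_sum _ _ _)) //; apply: ler_sum => j _.
rewrite linearZ normrZ ler_piMl // (le_trans (normr_entry_le H i j)) //.
Unshelve. all: by end_near. Qed.

End Differentiability.

(** A quadratic remainder is a little o of [H], and differentials are unique. General normed modules
    cover both the projection and curves defined on [R]. *)
Lemma diff_of_quadratic {R : realType} {V W : normedModType R} (f : V -> W) (A : V)
    (L : {linear V -> W}) (d C : R) : continuous L -> 0 < d -> 0 <= C ->
  (forall H, `|H| <= d -> `|f (A + H) - f A - L H| <= C * `|H| ^+ 2) ->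
  differentiable f A /\ 'd f A = L :> (_ -> _).
Proof.
move=> cL d0 C0 fA.
have fL : f \o shift A = cst (f A) + L +o_ (0 : V) id.
  apply/eqaddoP => _/posnumP[e]; near=> H.
  rewrite [X in `|X|](_ : _ = f (A + H) - f A - L H); last first.
    by rewrite !fctE /= opprD addrA (addrC H).
  have Hd : `|H| <= d by near: H; apply: nbhs0_le.
  apply: le_trans (fA H Hd) _; rewrite expr2 mulrA ler_wpM2r //.
  have : `|H| <= e%:num / (C + 1).
    by near: H; apply: nbhs0_le; rewrite divr_gt0 // ltr_wpDl.
  rewrite ler_pdivlMr ?ltr_wpDl // => h; apply: le_trans h.
  by rewrite mulrC ler_wpM2l // lerDl.
have dL := diff_unique cL fL.
by split => //; apply/diff_locallyP; rewrite dL.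
Unshelve. all: by end_near. Qed.

Lemma diff_of_order {R : realType} {l m p q : nat}
    (f : 'M[R]_(l, m) -> 'M[R]_(p, q)) (A : 'M[R]_(l, m))
    (L : {linear 'M[R]_(l, m) -> 'M[R]_(p, q)}) (d : R) : 0 < d ->
  of_order [set H | `|H| <= d] 2 (fun H => f (A + H) - f A - L H) ->
  differentiable f A /\ 'd f A = L :> (_ -> _).
Proof.
by move=> d0 [C C0 fA]; exact: (diff_of_quadratic (@linear_mx_continuous _ _ _ _ _ L) d0 C0).
Qed.

(** * The scalars x^T H y *)

Section BilinearForm.
Context {R : realType} {l m : nat}.

Lemma bilinE (x : 'cV[R]_l) (H : 'M[R]_(l, m)) y : x^T *m H *m y = (bilin x H y)%:M.
Proof. by rewrite /bilin -mx11_scalar. Qed.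

Lemma bilin_trE (x : 'cV[R]_l) (H : 'M[R]_(l, m)) y : y^T *m H^T *m x = (bilin x H y)%:M.
Proof. by apply: trmx_inj; rewrite tr_scalar_mx -bilinE !trmx_mul !trmxK mulmxA. Qed.

End BilinearForm.

Lemma linear_fun_ex {R : nzRingType} {U V : lmodType R} (f : U -> V) :
  linear f -> exists L : {linear U -> V}, L = f :> (U -> V).
Proof.
move=> lf; pose a := GRing.isLinear.Build R U V *:%R f lf.
pose L : {linear U -> V} := HB.pack f a.
by exists L.
Qed.

(** * The differential in terms of singular vectors *)

Section Differential.
Context {R : realType} {l m n : nat} (r : nat) (A : 'M[R]_(l, m)).
Variables (sigma : nat -> R) (u : nat -> 'cV[R]_l) (v : nat -> 'cV[R]_m).
Hypothesis svdA : is_svd n A sigma u v.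
Hypotheses (r0 : (0 < r)%N) (rn : (r <= n)%N) (sigma_r : 0 < sigma r).
Hypothesis sigma_gap : forall j, (r < j <= n)%N -> sigma j < sigma r.

Let orth_u : forall i j, (1 <= i <= n)%N -> (1 <= j <= n)%N ->
  (u i)^T *m u j = (i == j)%:R%:M.
Proof. by case: svdA. Qed.

Let P := proj_sum u 1 r.+1.
Let Q := 1%:M - P.
Let N := proj_sum v 1 r.+1.
Let T := @sylv R l n r sigma u.
Let D := @proj_diff R l m n r A sigma u.

Lemma proj_diff_linear : linear D.
Proof.
move=> a H H'; rewrite /D /proj_diff.
have -> : A *m (a *: H + H')^T + (a *: H + H') *m A^T =
    a *: (A *m H^T + H *m A^T) + (A *m H'^T + H' *m A^T).
  rewrite linearD linearZ /= mulmxDr mulmxDl -scalemxAr -scalemxAl.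
  by mxlin.
have solZ M : sylv_sol (n := n) r sigma u (a *: M) = a *: sylv_sol (n := n) r sigma u M.
  rewrite /sylv_sol scaler_sumr; apply: eq_bigr => i _.
  by rewrite -scalemxAr -scalemxAl.
rewrite sylv_solD solZ linearD linearZ /= mulmxDr -!scalemxAr !mulmxDl -!scalemxAl.
by apply/matrixP => i j; rewrite !mxlinE; ring.
Qed.

Definition svd_coef i j := sigma j / (sigma i ^+ 2 - sigma j ^+ 2).

Lemma sylv_svd i : (1 <= i <= r)%N ->
  T i *m A = \sum_(r.+1 <= j < n.+1) svd_coef i j *: (u j *m (v j)^T).
Proof.
move=> hi; have si := lt0r_neq0 (sigma_gt0 svdA rn sigma_r hi).
have QA : Q *m A = \sum_(r.+1 <= j < n.+1) sigma j *: (u j *m (v j)^T).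
  rewrite mulmxBl mul1mx (proj_sum_svd svdA rn) {1}(svdE svdA).
  rewrite (@big_cat_nat _ _ _ r.+1) //= addrC -addrA.
  rewrite (eq_bigr (fun j => sigma j *: (u j *m (v j)^T))); last first.
    by move=> j _; rewrite -scalemxAr.
  rewrite [X in _ + (X - _)](eq_bigr (fun j => sigma j *: (u j *m (v j)^T))).
    by rewrite subrr addr0.
  by move=> j _; rewrite -scalemxAr.
rewrite /T /sylv -scalemxAl mulmxDl -/P -/Q QA mulmx_suml -big_split scaler_sumr.
rewrite big_nat [RHS]big_nat; apply: eq_bigr => j hj /=.
have hj' : (1 <= j <= n)%N.
  by case/andP: hj => rj; rewrite ltnS => ->; rewrite (leq_ltn_trans _ rj).
rewrite -scalemxAl -mulmxA (svd_left svdA) // -scalemxAr scalerA -scalerDl scalerA.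
congr (_ *: _); rewrite /svd_coef.
have := sqr_sigma_lt svdA rn sigma_gap hi hj; rewrite -subr_gt0 => /lt0r_neq0 h.
by field; rewrite h si.
Qed.

Lemma sylv_scaled i : (1 <= i <= r)%N ->
  sigma i ^+ 2 *: T i = Q + \sum_(r.+1 <= j < n.+1)
    (sigma j * svd_coef i j) *: (u j *m (u j)^T).
Proof.
move=> hi; have si0 : sigma i ^+ 2 != 0.
  by rewrite sqrf_eq0 (lt0r_neq0 (sigma_gt0 svdA rn sigma_r hi)).
rewrite /T /sylv scalerA mulfV // scale1r; congr (_ + _).
by apply: eq_bigr => j _; rewrite /svd_coef mulrA -expr2.
Qed.

Lemma sylv_tr i : (T i)^T = T i.
Proof.
have QT : Q^T = Q by rewrite /Q linearB /= trmx1 proj_sum_tr.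
rewrite /T /sylv -/P -/Q linearZ /= linearD /= QT raddf_sum /=.
by congr (_ *: (_ + _)); apply: eq_bigr => j _; rewrite linearZ /= trmx_mul trmxK.
Qed.

Definition svd_term H i j : 'M[R]_(l, m) := svd_coef i j *:
  ((sigma j * bilin (u j) H (v i) + sigma i * bilin (u i) H (v j)) *: (u j *m (v i)^T) +
   (sigma i * bilin (u j) H (v i) + sigma j * bilin (u i) H (v j)) *: (u i *m (v j)^T)).

(** Multiplied by [A], the Sylvester solution yields [Q H N] and the terms in [u j (v i)^T]; its
    transpose yields the terms in [u i (v j)^T]. *)
Lemma proj_diffE H : D H = P *m H + Q *m H *m N +
  \sum_(1 <= i < r.+1) \sum_(r.+1 <= j < n.+1) svd_term H i j.
Proof.
set K := A *m H^T + H *m A^T.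
have KT : K^T = K by rewrite /K linearD /= !trmx_mul !trmxK addrC.
have e1 : sylv_sol (n := n) r sigma u K *m A = Q *m H *m N + \sum_(1 <= i < r.+1)
    \sum_(r.+1 <= j < n.+1) (svd_coef i j *
      (sigma j * bilin (u j) H (v i) + sigma i * bilin (u i) H (v j))) *: (u j *m (v i)^T).
  rewrite /N /proj_sum mulmx_sumr -big_split /= mulmx_suml.
  apply: (eq_sum_orth (n := n)) => // i hi hi'.
  have hir : (1 <= i <= r)%N by [].
  (* Since [A^T u_i = sigma i v_i], the part [H A^T] of [K] meets [sigma i ^+ 2 *: T i], whose
     leading term [Q] produces [Q H v_i]. *)
  have TKu : sigma i *: (T i *m K *m u i) = Q *m H *m v i +
      \sum_(r.+1 <= j < n.+1) (svd_coef i j *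
        (sigma j * bilin (u j) H (v i) + sigma i * bilin (u i) H (v j))) *: u j.
    rewrite -mulmxA mulmxDl -!mulmxA (svd_tr_right svdA) // -!scalemxAr mulmxDr.
    rewrite scalerDr -scalemxAr scalerA -expr2 [sigma i ^+ 2 *: (_ *m _)]scalemxAl.
    rewrite (sylv_scaled hir) mulmxDl mulmxA (sylv_svd hir) !mulmx_suml scaler_sumr.
    rewrite addrCA -big_split /=; congr (_ + _); apply: eq_bigr => j _.
    rewrite -!scalemxAl -!mulmxA (mulmxA _ H^T) bilin_trE (mulmxA _ H) bilinE.
    rewrite !mul_mx_scalar !scalerA -scalerDl; congr (_ *: _); ring.
  rewrite (_ : _ *m A = T i *m K *m u i *m (sigma i *: (v i)^T)); last first.
    by rewrite -(svd_left svdA) // !mulmxA.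
  rewrite -scalemxAr scalemxAl TKu mulmxDl mulmx_suml !mulmxA; congr (_ + _).
  by apply: eq_bigr => j _; rewrite -scalemxAl.
have e2 : (sylv_sol (n := n) r sigma u K)^T *m A = \sum_(1 <= i < r.+1)
    \sum_(r.+1 <= j < n.+1) (svd_coef i j *
      (sigma i * bilin (u j) H (v i) + sigma j * bilin (u i) H (v j))) *: (u i *m (v j)^T).
  rewrite /sylv_sol raddf_sum mulmx_suml; apply: (eq_sum_orth (n := n)) => // i hi hi'.
  have hir : (1 <= i <= r)%N by [].
  rewrite /= !trmx_mul trmxK KT sylv_tr -!mulmxA -/T (sylv_svd hir) !mulmx_sumr.
  apply: (eq_sum_orth (n := n)) => // j _ hj.
  rewrite -!scalemxAr -scalerA; congr (_ *: _).
  have Ku : (u i)^T *m K *m u j =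
      (sigma i * bilin (u j) H (v i) + sigma j * bilin (u i) H (v j))%:M.
    rewrite mulmxDr mulmxDl !mulmxA (svd_left svdA) // -!scalemxAl bilin_trE.
    rewrite -(mulmxA _ A^T) (svd_tr_right svdA) // -scalemxAr bilinE.
    by rewrite !scale_scalar_mx -raddfD.
  by rewrite (mulmxA K) (mulmxA _ (K *m u j)) (mulmxA _ K) Ku mul_scalar_mx scalemxAr.
rewrite /D /proj_diff -/K mulmxDl e1 e2 addrC -!addrA; congr (_ + (_ + _)).
rewrite -big_split; apply: eq_bigr => i _ /=; rewrite -big_split; apply: eq_bigr => j _ /=.
by rewrite /svd_term scalerDr !scalerA.
Qed.

End Differential.

(** * Quadratic curves, a family of smooth curves stable under derivation *)

Section QuadraticCurve.
Context {R : realType} {l m : nat}.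
Let V : normedModType R := 'M[R]_(l, m).

Definition qcurve (a b c : V) (t : R) : V := a + t *: b + t ^+ 2 *: c.

Lemma qcurve_diff a b c (t : R) :
  derivable (qcurve a b c) t 1 /\ (qcurve a b c)^`()%classic t = qcurve b (2 *: c) 0 t.
Proof.
pose w := b + t *: (2 *: c).
have [L LE] := @linear_fun_ex R R^o V (fun h : R^o => h *: w)
  (fun a x y => etrans (scalerDl _ _ _) (congr1 (fun z => z + _) (esym (scalerA _ _ _)))).
have cL : continuous L by rewrite LE; exact: scalel_continuous.
have [|df dE] := @diff_of_quadratic R R^o V (qcurve a b c) t L 1 `|c| cL ltr01 (normr_ge0 _).
  move=> h _; rewrite LE /qcurve /w.
  (* The increment minus its linear part is exactly [h^2 c], whence the constant [|c|]. *)
  rewrite [X in `|X|](_ : _ = h ^+ 2 *: c); first by rewrite normrZ normrX mulrC.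
  by apply/matrixP => i j; rewrite !mxlinE; ring.
split; first exact/derivable1_diffP.
by rewrite derive1E' // dE LE scale1r /qcurve /w scaler0 addr0.
Qed.

Lemma qcurve_derive1n a b c n :
  exists a' b' c', (qcurve a b c)^`(n)%classic = qcurve a' b' c'.
Proof.
elim: n a b c => [|n IH] a b c; first by exists a, b, c; rewrite derive1n0.
rewrite derive1Sn; have -> : (qcurve a b c)^`()%classic = qcurve b (2 *: c) 0.
  by apply/funext => t; have [] := qcurve_diff a b c t.
exact: IH.
Qed.

End QuadraticCurve.

(** * Tangent space of the fixed rank manifold and projection onto it *)

Section TangentSpace.
Context {R : realType}.

(** If [K (1 + B) = 0] then [B^T K^T = - K^T], so [|K|^2 <= l |B| |K|^2] in Frobenius norm of [K],
    which forces [K = 0]. *)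
Lemma unitmx_1D {l} (B : 'M[R]_l) : l%:R * `|B| < 1 -> 1%:M + B \in unitmx.
Proof.
move=> hB; rewrite -row_free_unit -kermx_eq0; apply/eqP.
set K := kermx _; have KB : K *m (1%:M + B) = 0 by exact: mulmx_ker.
have BK : B^T *m K^T = - K^T.
  rewrite -trmx_mul -raddfN; congr (_^T); apply/eqP.
  by rewrite -addr_eq0 addrC -[X in X + _](mulmx1 K) -mulmxDr KB.
apply: trmx_inj; rewrite trmx0; apply: frob_eq0.
have := normr_quad_le B^T K^T; rewrite BK frobNr normrN ger0_norm ?frob_ge0 // => h.
have h2 := ler_wpM2r (frob_ge0 K^T) (ler_wpM2l (ler0n R l) (normr_trmx B)).
have h3 := le_trans h h2; rewrite leNgt; apply/negP => h4.
by have := ltr_pM2r h4 (l%:R * `|B|) 1; rewrite hB mul1r ltNge h3.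
Qed.

Lemma rank_proj_id {l m} (W : 'M[R]_(l, m)) : rank_proj (\rank W) W = W.
Proof.
have nW : is_nearest (@fixed_rank R l m (\rank W)) W W.
  by split=> // X _; rewrite subrr /frob_norm frob0l sqrtr0 sqrtr_ge0.
have uW Y : is_nearest (@fixed_rank R l m (\rank W)) W Y -> Y = W.
  move=> [_ /(_ W erefl)]; rewrite subrr /frob_norm frob0l sqrtr0 => h.
  apply/esym/subr0_eq/frob_eq0; rewrite -sqrtr_eq0.
  by apply/eqP/le_anti; rewrite h sqrtr_ge0.
rewrite /rank_proj; case: xgetP => [Y -> [/uW //]|/(_ W)].
by case; split.
Qed.

Lemma frob_mulmxr {m n p} (A : 'M[R]_(m, n)) (B : 'M[R]_(n, p)) C :
  frob (A *m B) C = frob A (C *m B^T).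
Proof. by rewrite /frob trmx_mul -mulmxA mxtrace_mulC mulmxA. Qed.

Section AtSvd.
Context {l m r : nat} (Y : 'M[R]_(l, m)).
Variables (sigma : nat -> R) (u : nat -> 'cV[R]_l) (v : nat -> 'cV[R]_m).
Hypotheses (svdY : is_svd r Y sigma u v) (r0 : (0 < r)%N) (sigma_r : 0 < sigma r).

Let orth_u : forall i j, (1 <= i <= r)%N -> (1 <= j <= r)%N ->
  (u i)^T *m u j = (i == j)%:R%:M.
Proof. by case: svdY. Qed.

Let orth_v : forall i j, (1 <= i <= r)%N -> (1 <= j <= r)%N ->
  (v i)^T *m v j = (i == j)%:R%:M.
Proof. by case: svdY. Qed.

Let P := proj_sum u 1 r.+1.
Let Q := 1%:M - P.
Let N := proj_sum v 1 r.+1.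

(** The Moore-Penrose inverse of [Y]. *)
Definition svd_pinv : 'M[R]_(m, l) :=
  \sum_(1 <= i < r.+1) (sigma i)^-1 *: (v i *m (u i)^T).

Lemma mulmx_svd_pinv : Y *m svd_pinv = P.
Proof.
rewrite mulmx_sumr; apply: (eq_sum_orth (n := r)) => // i _ hi.
rewrite -scalemxAr mulmxA (svd_right svdY) // -scalemxAl scalerA mulVf ?scale1r //.
exact: lt0r_neq0 (sigma_gt0 svdY (leqnn r) sigma_r hi).
Qed.

Lemma svd_pinv_mulmx : svd_pinv *m Y = N.
Proof.
rewrite mulmx_suml; apply: (eq_sum_orth (n := r)) => // i _ hi.
rewrite -scalemxAl -mulmxA (svd_left svdY) // -scalemxAr scalerA mulVf ?scale1r //.
exact: lt0r_neq0 (sigma_gt0 svdY (leqnn r) sigma_r hi).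
Qed.

Lemma mulmx_proj_svd : P *m Y = Y.
Proof. by rewrite (proj_sum_svd svdY (leqnn r)); case: svdY. Qed.

Lemma rank_svd : \rank Y = r.
Proof.
apply/eqP; rewrite -(eqr_nat R) -(mxtrace_svd_proj svdY (leqnn r)).
rewrite (mxtrace_oproj (is_oproj_proj_sum orth_u _ _)) // eqr_nat eqn_leq.
by rewrite -{1}mulmx_proj_svd mxrankM_maxl -{1}[proj_sum _ _ _]mulmx_svd_pinv mxrankM_maxl.
Qed.

(** Any such factors span the column and row spaces of [Y]. Two symmetric projections, each fixing
    the range of the other, coincide by transposition. *)
Lemma thin_factor_projections (U : 'M[R]_(l, r)) (Z : 'M[R]_(m, r)) :
  U^T *m U = 1%:M -> \rank Z = r -> Y = U *m Z^T ->
  U *m U^T = P /\ Z *m invmx (Z^T *m Z) *m Z^T = N.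
Proof.
move=> UU rZ YE; have uZ := gram_unitmx rZ.
have [PT PP] : is_oproj P by exact: (is_oproj_proj_sum orth_u).
have [NT NN] : is_oproj N by exact: (is_oproj_proj_sum orth_v).
have [WT _] := oproj_gram rZ; set W := Z *m _ *m _ in WT *.
split.
  have PU : P *m U = U.
    have UE : U = Y *m (Z *m invmx (Z^T *m Z)).
      by rewrite YE -mulmxA (mulmxA Z^T) mulmxV // mulmx1.
    by rewrite UE mulmxA mulmx_proj_svd.
  have UP : U *m U^T *m P = P.
    by rewrite -mulmx_svd_pinv YE !mulmxA -(mulmxA U) UU mulmx1.
  by rewrite -{1}PU -mulmxA -[RHS]PT -[P in RHS]UP !trmx_mul trmxK PT.
have YN : Y *m N = Y by rewrite -svd_pinv_mulmx mulmxA mulmx_svd_pinv mulmx_proj_svd.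
have ZN : Z^T *m N = Z^T.
  have ZE : Z^T = U^T *m Y by rewrite YE mulmxA UU mul1mx.
  by rewrite ZE -mulmxA YN.
have YW : Y *m W = Y.
  by rewrite /W YE -!mulmxA (mulmxA Z^T Z) (mulmxA _ (invmx _)) mulmxV // mul1mx.
have NW : N *m W = N by rewrite -svd_pinv_mulmx -mulmxA YW.
have WN : W *m N = W by rewrite /W -mulmxA ZN.
by rewrite -[RHS]NT -[N in RHS]NW trmx_mul WT NT WN.
Qed.

Let no_gap j : (r < j <= r)%N -> sigma j < sigma r.
Proof. by case/andP=> /leq_trans h /h; rewrite ltnn. Qed.

(* [rank_proj r] fixes the manifold, so its differential at [Y] fixes every
   tangent vector. *)
Lemma tangent_spaceP T : tangent_space (@fixed_rank R l m r) Y T <->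
  T = P *m T + Q *m T *m N.
Proof.
split=> [[g [e [e0 gM gD g0 gT]]]|TE].
  have [d d0 od] := rank_proj_expansion svdY r0 (leqnn r) sigma_r no_gap.
  have [L LE] := linear_fun_ex (@proj_diff_linear R l m r r Y sigma u).
  have [|df dE] := @diff_of_order _ _ _ _ _ (@rank_proj R l m r) Y L d d0.
    by rewrite LE.
  have /derivable1_diffP dg : derivable g 0 1 by apply: (gD 0 0%N); rewrite normr0.
  have fg : \forall t \near (0 : R), (@rank_proj R l m r \o g) t = g t.
    near=> t; have tg : fixed_rank r (g t).
      apply: gM; near: t. exact: (@pseudometric_normed_Zmodule.nbhs0_lt R R^o).
    by rewrite /= -[in LHS]tg rank_proj_id.
  have dfg : 'D_1 (@rank_proj R l m r \o g) 0 = 'D_1 g 0 by exact: near_eq_derive.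
  have df' : differentiable (@rank_proj R l m r) (g 0) by rewrite g0.
  move: (gT); rewrite derive1E -dfg deriveE; last exact: differentiable_comp.
  rewrite diff_comp //= g0 dE LE -deriveE // -derive1E gT.
  rewrite (proj_diffE svdY (leqnn r) sigma_r no_gap) => {1}<-.
  (* Here [n = r]: no singular value lies beyond [r], and the inner sums are empty. *)
  by rewrite [X in _ + X]big1 ?addr0 // => i _; rewrite big_geq.
(* Chosen so that [B Y = Q T N] and [Y C = P T], whose sum is [T]. *)
pose B := Q *m T *m svd_pinv; pose C := svd_pinv *m T.
have BYC : B *m Y + Y *m C = T.
  by rewrite /B /C (mulmxA Y) mulmx_svd_pinv -(mulmxA _ svd_pinv) svd_pinv_mulmx addrC -TE.
(* For [|t| < c^-1] both [t B] and [t C] satisfy the smallness condition of [unitmx_1D], so the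
   curve keeps rank [r]; the [+ 1] makes [c] positive. *)
pose c := l%:R * `|B| + m%:R * `|C| + 1.
have c0 : 0 < c by rewrite ltr_wpDl // addr_ge0 // mulr_ge0.
exists (qcurve Y T (B *m Y *m C)), c^-1; split.
- by rewrite invr_gt0.
- move=> t ht.
  have htc : `|t| * c < 1 by rewrite -ltr_pdivlMr // div1r.
  have uB : 1%:M + t *: B \in unitmx.
    apply: unitmx_1D; rewrite normrZ mulrCA; apply: le_lt_trans htc.
    by rewrite ler_wpM2l // /c -addrA lerDl addr_ge0 // mulr_ge0.
  have uC : 1%:M + t *: C \in unitmx.
    apply: unitmx_1D; rewrite normrZ mulrCA; apply: le_lt_trans htc.
    by rewrite ler_wpM2l // /c addrAC lerDr addr_ge0 // mulr_ge0.
  have -> : qcurve Y T (B *m Y *m C) t = (1%:M + t *: B) *m Y *m (1%:M + t *: C).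
    rewrite /qcurve -BYC mulmxDl mul1mx -[_ *: B *m Y]scalemxAl mulmxDr mulmx1.
    rewrite -scalemxAr mulmxDl -[_ *: _ *m C]scalemxAl.
    by apply/matrixP => i j; rewrite !mxlinE; ring.
  by rewrite /fixed_rank /= mxrankMfree ?row_free_unit // eqmxMfull ?row_full_unit // rank_svd.
- move=> t k _; have [a [b [d ->]]] := qcurve_derive1n Y T (B *m Y *m C) k.
  by have [] := qcurve_diff a b d t.
- by rewrite /qcurve scale0r expr0n scale0r !addr0.
- have [_ ->] := qcurve_diff Y T (B *m Y *m C) 0.
  by rewrite /qcurve scale0r expr0n scale0r !addr0.
Unshelve. all: by end_near.
Qed.

Lemma orth_proj_tangent X :
  orth_proj (tangent_space (@fixed_rank R l m r) Y) X = P *m X + Q *m X *m N.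
Proof.
have hP : is_oproj P by exact: (is_oproj_proj_sum orth_u).
have hN : is_oproj N by exact: (is_oproj_proj_sum orth_v).
have [QT QQ] := is_oprojC hP; have [NT NN] := hN; have [PT PP] := hP.
have TX : tangent_space (@fixed_rank R l m r) Y (P *m X + Q *m X *m N).
  apply/tangent_spaceP; rewrite /Q !mxmulE.
  by rewrite !(PP, NN, oprojK _ hP, oprojK _ hN); mxlin.
have orth W : tangent_space (@fixed_rank R l m r) Y W ->
    frob (X - (P *m X + Q *m X *m N)) W = 0.
  move=> /tangent_spaceP WE.
  have -> : X - (P *m X + Q *m X *m N) = Q *m (X *m (1%:M - N)).
    by rewrite /Q; mxlin.
  rewrite frob_mulmxl QT frob_mulmxr (proj1 (is_oprojC hN)) WE /Q !mxmulE.
  by rewrite !(PP, NN, oprojK _ hP, oprojK _ hN) (_ : _ + _ = 0) ?[frob _ 0]frobC ?frob0l //; mxlin.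
rewrite /orth_proj; case: xgetP => [Z _ [TZ oZ]|/(_ (P *m X + Q *m X *m N))]; last by case; split.
(* The difference of two candidates is tangent and orthogonal to all tangent vectors, hence to
   itself. *)
have TD : tangent_space (@fixed_rank R l m r) Y (P *m X + Q *m X *m N - Z).
  move/tangent_spaceP: TX => XE; move/tangent_spaceP: TZ => ZE.
  apply/tangent_spaceP; rewrite {1}XE {1}ZE; mxlin.
apply/esym/subr0_eq/frob_eq0.
rewrite {1}(_ : _ - Z = (X - Z) - (X - (P *m X + Q *m X *m N))).
  by rewrite frobDl frobNl oZ // orth // subrr.
by apply/matrixP => i j; rewrite !mxlinE; ring.
Qed.

End AtSvd.
End TangentSpace.

(** * From the matrices Phi to the explicit terms *)

Section PhiTerms.
Context {R : realType} {l m : nat}.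

Lemma frob_bilin (X : 'M[R]_(l, m)) (x : 'cV[R]_l) (y : 'cV[R]_m) :
  frob X (x *m y^T) = bilin x X y.
Proof.
by rewrite /frob mulmxA mxtrace_mulC mulmxA bilin_trE mxtrace_scalar mulr1n.
Qed.

Lemma Phi_terms (sigma : nat -> R) (u : nat -> 'cV[R]_l) (v : nat -> 'cV[R]_m) X i p :
  sigma i - sigma p != 0 -> sigma i + sigma p != 0 ->
  (sigma p / (sigma i - sigma p) * frob X (Phi_plus u v i p)) *: Phi_plus u v i p -
  (sigma p / (sigma i + sigma p) * frob X (Phi_minus u v i p)) *: Phi_minus u v i p =
  svd_term sigma u v X i p.
Proof.
move=> hB hD; rewrite /Phi_plus /Phi_minus !frobZr !frobDr frobNr !frob_bilin.
have h2 : (Num.sqrt 2)^-1 * (Num.sqrt 2)^-1 = 2^-1 :> R.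
  by rewrite -invfM -expr2 sqr_sqrtr.
set h := (Num.sqrt 2)^-1 in h2 *; rewrite /svd_term /svd_coef.
set a := bilin _ _ _; set b := bilin _ _ _.
set s := sigma i in hB hD *; set c := sigma p in hB hD *.
apply/matrixP => i' j'; rewrite !mxlinE; set M := (_ *m _) i' j'; set N := (_ *m _) i' j'.
(* Gathers the square roots in [h * h = 1/2]; what remains is partial fractions over [s^2 - c^2]. *)
transitivity (h * h * (c / (s - c) * (a + b) * (M + N) - c / (s + c) * (a - b) * (M - N))).
  ring.
rewrite h2; have -> : s ^+ 2 - c ^+ 2 = (s - c) * (s + c) by ring.
by field; rewrite hB hD.
Qed.

End PhiTerms.

Theorem theorem4p6 (R : realType) (l m r k : nat) (A : 'M[R]_(l, m))
    (sigma : nat -> R) (u : nat -> 'cV[R]_l) (v : nat -> 'cV[R]_m)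
    (hr : (0 < r)%N) (hk : (0 < k)%N)
    (hrank : \rank A = (r + k)%N)
    (hsvd : is_svd (r + k) A sigma u v)
    (hgap : sigma r.+1 < sigma r) :
  [/\ rank_proj r A = \sum_(1 <= i < r.+1) sigma i *: (u i *m (v i)^T),
      differentiable (@rank_proj R l m r) A,
      forall X : 'M[R]_(l, m),
        'd (@rank_proj R l m r) A X =
        orth_proj (tangent_space (@fixed_rank R l m r) (rank_proj r A)) X +
        \sum_(1 <= i < r.+1) \sum_(1 <= j < k.+1)
          ((sigma (r + j)%N / (sigma i - sigma (r + j)%N) *
              frob X (Phi_plus u v i (r + j))) *: Phi_plus u v i (r + j) -
           (sigma (r + j)%N / (sigma i + sigma (r + j)%N) *
              frob X (Phi_minus u v i (r + j))) *: Phi_minus u v i (r + j))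
    & forall (U : 'M[R]_(l, r)) (Z : 'M[R]_(m, r)),
        U^T *m U = 1%:M -> \rank Z = r -> rank_proj r A = U *m Z^T ->
        forall X : 'M[R]_(l, m),
        'd (@rank_proj R l m r) A X =
        (1%:M - U *m U^T) *m X *m Z *m invmx (Z^T *m Z) *m Z^T +
        U *m U^T *m X +
        \sum_(1 <= i < r.+1) \sum_(1 <= j < k.+1)
          (sigma (r + j)%N / (sigma i ^+ 2 - sigma (r + j)%N ^+ 2)) *:
          ((sigma (r + j)%N * bilin (u (r + j)%N) X (v i) +
            sigma i * bilin (u i) X (v (r + j)%N)) *:
             (u (r + j)%N *m (v i)^T) +
           (sigma i * bilin (u (r + j)%N) X (v i) +
            sigma (r + j)%N * bilin (u i) X (v (r + j)%N)) *:
             (u i *m (v (r + j)%N)^T))].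
Proof.
have rn : (r <= r + k)%N by exact: leq_addr.
have r1n : (r < r + k)%N by rewrite -addn1 leq_add2l.
have [_ _ s0 sdec _] := hsvd.
have sigma_r : 0 < sigma r by apply: le_lt_trans hgap; exact: s0.
have sigma_gap j : (r < j <= r + k)%N -> sigma j < sigma r.
  by case/andP=> rj jn; apply: le_lt_trans hgap; exact: sdec.
have YE := rank_proj_svd hsvd hr rn sigma_r sigma_gap.
have YS : rank_proj r A = \sum_(1 <= i < r.+1) sigma i *: (u i *m (v i)^T).
  by rewrite YE (proj_sum_svd hsvd rn).
(* The truncated sum is itself a decomposition with [n = r], so the tangent space results apply at
   the projected point. *)
have svdY : is_svd r (rank_proj r A) sigma u v.
  case: hsvd => ou ov _ _ _; split => // [i j hi hj|i j hi hj|i hi|i j i1 ij jr].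
  - by apply: ou; [case/andP: hi|case/andP: hj] => -> /leq_trans ->.
  - by apply: ov; [case/andP: hi|case/andP: hj] => -> /leq_trans ->.
  - by apply: s0; case/andP: hi => -> /leq_trans ->.
  - by apply: sdec => //; exact: leq_trans jr rn.
have [d d0 od] := rank_proj_expansion hsvd hr rn sigma_r sigma_gap.
have [L LE] := linear_fun_ex (@proj_diff_linear R l m (r + k) r A sigma u).
have [|df dE] := @diff_of_order _ _ _ _ _ (@rank_proj R l m r) A L d d0.
  by rewrite LE.
have DE X : 'd (@rank_proj R l m r) A X =
    proj_sum u 1 r.+1 *m X + (1%:M - proj_sum u 1 r.+1) *m X *m proj_sum v 1 r.+1 +
    \sum_(1 <= i < r.+1) \sum_(1 <= j < k.+1) svd_term sigma u v X i (r + j).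
  rewrite dE LE (proj_diffE hsvd rn sigma_r sigma_gap); congr (_ + _).
  (* Shifts the index from [r + 1 .. r + k] to [1 .. k]. *)
  apply: eq_bigr => i _; rewrite -[r.+1]add1n big_addn -addnS addKn.
  by apply: eq_bigr => j _; rewrite addnC.
split => // [X|U Z UU rZ YUZ X]; rewrite DE.
- rewrite (orth_proj_tangent svdY hr sigma_r); congr (_ + _).
  apply: eq_big_nat => i hi; apply: eq_big_nat => j /andP[j1 jk].
  have hj : (r < r + j <= r + k)%N by rewrite -[X in (X < _)%N]addn0 ltn_add2l j1 leq_add2l.
  have [i1 ir] := andP hi.
  have sij : sigma (r + j)%N < sigma i.
    by apply: lt_le_trans (sigma_gap _ hj) _; exact: sdec.
  have sj : 0 <= sigma (r + j)%N.
    by apply: s0; case/andP: hj => /(leq_ltn_trans _) -> // ->.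
  rewrite Phi_terms //; apply: lt0r_neq0; first by rewrite subr_gt0.
  by apply: ltr_pwDl => //; exact: le_lt_trans sij.
- have [-> WE] := thin_factor_projections svdY sigma_r UU rZ YUZ.
  by congr (_ + _); rewrite addrC -WE !mulmxA.
Qed.
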